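(* Let $m\ge 2$ and $n\ge 1$ be integers, and let $G_n^p$ be the perfect $m$-caterpillar of length $n$. Then \[ M(G_n^p)\simeq \begin{cases} \bigvee_{t=0}^{k}\ \bigvee_{\alpha_t} S^{k-1+t} & \text{if } n=2k,\\[4pt] \bigvee_{t=0}^{k}\ \bigvee_{\beta_t} S^{k+t} & \text{if } n=2k+1,\end{cases}\] where $\alpha_t=\binom{k+t}{k-t}(m-1)^{2t}$ and $\beta_t=\binom{k+1+t}{k-t}(m-1)^{2t+1}$, and $\bigvee_{c} S^j$ denotes a wedge of $c$ copies of $S^j$.
   Context: For a finite simple graph $G$, the matching complex $M(G)$ is the simplicial complex whose vertex set is $E(G)$ and whose faces are the matchings of $G$ (sets of pairwise vertex-disjoint edges). A caterpillar graph is a tree in which every vertex lies on a central path or is adjacent to a vertex of it. The perfect $m$-caterpillar of length $n$ is the tree consisting of a central path $v_1v_2\cdots v_n$ with exactly $m$ pendant leaves (legs) attached to each $v_i$. *)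

(* Defs.v *)
From HB Require Import structures.
From mathcomp Require Import all_boot all_order all_algebra.
From mathcomp Require Import all_classical all_reals all_analysis.
From mathcomp Require Import wedge_sigT.
Import Order.TTheory GRing.Theory Num.Theory.
Import numFieldNormedType.Exports.

Set Implicit Arguments.
Unset Strict Implicit.
Unset Printing Implicit Defensive.

Local Open Scope ring_scope.

Record sgraph := SGraph {
  vertex :> finType;
  adj : rel vertex;
  adj_sym : symmetric adj;
  adj_irrefl : irreflexive adj }.

Definition edges (G : sgraph) : {set {set G}} :=
  [set [set p.1; p.2] | p in [set p : G * G | adj p.1 p.2]]%SET.

Definition edge (G : sgraph) : finType := {e : {set G} | e \in edges G}.

(* The empty face is allowed; it does not contribute to the realization. *)
Record scomplex := SComplex {
  sc_vertex :> finType;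
  faces : {set {set sc_vertex}};
  faces1 : forall v, [set v]%SET \in faces;
  faces_sub : forall A B : {set sc_vertex},
    B \subset A -> A \in faces -> B \in faces }.

Definition matching (G : sgraph) (A : {set edge G}) : bool :=
  [forall e in A, forall f in A, (e != f) ==> [disjoint val e & val f]].

Definition matchings (G : sgraph) : {set {set edge G}} :=
  [set A | matching A]%SET.

Lemma matchings1 (G : sgraph) (e : edge G) : [set e]%SET \in matchings G.
Proof.
rewrite inE; apply/forall_inP => f /set1P ->.
by apply/forall_inP => g /set1P ->; rewrite eqxx.
Qed.

Lemma matchings_sub (G : sgraph) (A B : {set edge G}) :
  B \subset A -> A \in matchings G -> B \in matchings G.
Proof.
move=> /fintype.subsetP sBA; rewrite !inE => /forall_inP mA.
apply/forall_inP => e Be; apply/forall_inP => f Bf.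
by have /forall_inP := mA e (sBA e Be); apply; exact: sBA.
Qed.

Definition matching_complex (G : sgraph) : scomplex :=
  SComplex (@matchings1 G) (@matchings_sub G).

(* Barycentric coordinates; [{ptws K -> R}] is R^K with the product topology. *)
Definition barycentric (R : realType) (K : scomplex) (x : {ptws K -> R}) :=
  [/\ forall v : K, 0 <= x v, \sum_(v : K) x v = 1 &
      [set v : K | x v != 0]%SET \in faces K].

Definition realization (R : realType) (K : scomplex) : topologicalType :=
  set_type [set x : {ptws K -> R} | barycentric x]%classic.

Definition homotopic (R : realType) (X Y : topologicalType) (f g : X -> Y) :=
  exists H : X * R -> Y,
    [/\ {within [set: X] `*` `[0, 1], continuous H}%classic,
        forall x, H (x, 0) = f x &
        forall x, H (x, 1) = g x].

Definition homotopy_equivalent (R : realType) (X Y : topologicalType) :=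
  exists (f : X -> Y) (g : Y -> X),
    [/\ continuous f, continuous g,
        homotopic R (g \o f) idfun & homotopic R (f \o g) idfun].

Definition unit_vector (R : realType) (d : nat) (x : 'rV[R]_d.+1) :=
  \sum_(i < d.+1) x ord0 i ^+ 2 = 1.

Definition sphere (R : realType) (d : nat) : topologicalType :=
  set_type [set x : 'rV[R]_d.+1 | unit_vector x]%classic.

Lemma delta_mx_unit (R : realType) (d : nat) :
  (delta_mx ord0 ord0 : 'rV[R]_d.+1) \in
    [set x : 'rV[R]_d.+1 | unit_vector x]%classic.
Proof.
rewrite inE /= /unit_vector (bigD1 ord0) //= big1 ?addr0 => [|i /negbTE i0].
  by rewrite mxE !eqxx expr1n.
by rewrite mxE i0 andbF expr0n.
Qed.

Definition sphere_base (R : realType) (d : nat) : sphere R d :=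
  SigSub (delta_mx_unit R d).

(* The iterated wedge over t <= k and over c t copies of S^(d t), as one wedge
   indexed by the disjoint union of the index sets. *)
Definition wedge_spheres (R : realType) (k : nat) (c d : nat -> nat) :
    topologicalType :=
  @wedge {t : 'I_k.+1 & 'I_(c t)} (fun i => sphere R (d (tag i)))
         (fun i => sphere_base R (d (tag i))).

Section PerfectCaterpillar.
Variables m n : nat.

(* [inl i] is the i-th central vertex, [inr (i, j)] its j-th leg. *)
Definition caterpillar_adj (x y : 'I_n + 'I_n * 'I_m) : bool :=
  match x, y with
  | inl i, inl j => (i.+1 == j :> nat) || (j.+1 == i :> nat)
  | inl i, inr (j, _) => i == j
  | inr (i, _), inl j => i == j
  | inr _, inr _ => false
  end.

Lemma caterpillar_adj_sym : symmetric caterpillar_adj.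
Proof. by move=> [i|[i a]] [j|[j b]] //=; rewrite 1?orbC 1?eq_sym. Qed.

Lemma caterpillar_adj_irrefl : irreflexive caterpillar_adj.
Proof. by move=> [i|[i a]] //=; rewrite orbb eqn_leq ltnn. Qed.

Definition perfect_caterpillar : sgraph :=
  SGraph caterpillar_adj_sym caterpillar_adj_irrefl.

End PerfectCaterpillar.

Definition alpha (m k t : nat) : nat :=
  ('C(k + t, k - t) * (m - 1) ^ (2 * t))%N.

Definition beta (m k t : nat) : nat :=
  ('C(k + 1 + t, k - t) * (m - 1) ^ (2 * t + 1))%N.

(* Main.v *)
(* Call a matching critical if it covers every central vertex and uses no first
   leg.  A non-critical matching misses some central vertex, up to its first
   leg; toggling the first leg at the first such vertex pairs off the
   non-critical matchings.  Geometrically, the non-critical matchings form a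
   subcomplex that collapses to a point: the star of each partial matching
   which covers exactly the central vertices v_1, ..., v_i, without first legs,
   can be pushed towards the first leg of v_(i+1), longer ones being removed
   first.  The critical matchings are facets, so the matching complex is a
   contractible subcomplex with open cells of dimension #|P| - 1 attached, and
   the quotient by the subcomplex is a wedge of spheres.  The quotient map is a
   homotopy equivalence because the contraction extends to the whole complex by
   an explicit radial formula on the critical simplices.  Critical matchings are
   tilings of the path by dominoes and by single vertices in m - 1 colours. *)
Require Import Defs.
From mathcomp Require Import all_boot all_order all_algebra.
From mathcomp Require Import all_classical all_reals all_analysis.
From mathcomp Require Import wedge_sigT.
From mathcomp Require Import zify ring lra.
Set Implicit Arguments.
Unset Strict Implicit.
Unset Printing Implicit Defensive.
Import Order.TTheory GRing.Theory Num.Theory.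
Import numFieldNormedType.Exports.
Local Open Scope classical_set_scope.
Local Open Scope ring_scope.

(** * Continuity and quotients *)

Section Continuity.
Variables (R : realType) (T : topologicalType).

Lemma continuous_ptws (V : choiceType) (f : T -> {ptws V -> R}) :
  (forall v, continuous (fun t => f t v)) -> continuous f.
Proof.
move=> cf t; apply/cvg_sup => v U [/= _ [[W oW <-] /= Wft] sWU].
by apply: filterS sWU _; apply: (cf v t); exact: open_nbhs_nbhs.
Qed.

Lemma continuous_coord (V : choiceType) (f : T -> {ptws V -> R}) v :
  continuous f -> continuous (fun t => f t v).
Proof.
move=> cf t.
exact: (@continuous_comp _ _ _ f _ t (cf t) (@proj_continuous V (fun=> R) v _)).
Qed.

Lemma continuous_cstR (a : R) : continuous (fun _ : T => a).
Proof. exact: cst_continuous. Qed.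

Lemma continuous_addR (f g : T -> R) :
  continuous f -> continuous g -> continuous (fun t => f t + g t).
Proof. by move=> cf cg t; apply: cvgD; [exact: cf|exact: cg]. Qed.

Lemma continuous_subR (f g : T -> R) :
  continuous f -> continuous g -> continuous (fun t => f t - g t).
Proof. by move=> cf cg t; apply: cvgB; [exact: cf|exact: cg]. Qed.

Lemma continuous_mulR (f g : T -> R) :
  continuous f -> continuous g -> continuous (fun t => f t * g t).
Proof. by move=> cf cg t; apply: cvgM; [exact: cf|exact: cg]. Qed.

Lemma continuous_invR (f : T -> R) :
  (forall t, f t != 0) -> continuous f -> continuous (fun t => (f t)^-1).
Proof. by move=> f0 cf t; apply: cvgV; [exact: f0|exact: cf]. Qed.

Lemma continuous_minR (f g : T -> R) :
  continuous f -> continuous g -> continuous (fun t => Num.min (f t) (g t)).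
Proof. by move=> cf cg t; apply: continuous_min; [exact: cf|exact: cg]. Qed.

Lemma continuous_maxR (f g : T -> R) :
  continuous f -> continuous g -> continuous (fun t => Num.max (f t) (g t)).
Proof. by move=> cf cg t; apply: continuous_max; [exact: cf|exact: cg]. Qed.

Lemma continuous_sum (I : Type) (r : seq I) (P : pred I) (f : I -> T -> R) :
  (forall i, continuous (f i)) ->
  continuous (fun t => \sum_(i <- r | P i) f i t).
Proof.
move=> cf; elim: r => [|i r IH].
  by under eq_fun do rewrite big_nil; exact: continuous_cstR.
under eq_fun do rewrite big_cons.
by case: (P i) => //; exact: continuous_addR.
Qed.

Lemma continuous_bigmin (I : Type) (r : seq I) (x0 : T -> R) (f : I -> T -> R) :
  continuous x0 -> (forall i, continuous (f i)) ->
  continuous (fun t => \big[Num.min/x0 t]_(i <- r) f i t).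
Proof.
move=> cx cf; elim: r => [|i r IH]; first by under eq_fun do rewrite big_nil.
under eq_fun do rewrite big_cons.
exact: continuous_minR.
Qed.

Lemma continuous_row n (f : T -> 'rV[R]_n) :
  (forall i, continuous (fun t => f t ord0 i)) -> continuous f.
Proof.
move=> cf t; apply/cvg_mx_entourageP => A entA.
have H : \forall s \near t, forall j, A (f t ord0 j, f s ord0 j).
  apply: filter_forall => j.
  by have /cvg_entourageP /(_ _ entA) := cf j t.
by apply: filterS H => s Hs i j; rewrite ord1; apply/mem_set; exact: Hs.
Qed.

End Continuity.

Section Subtype.
Variables (X T : topologicalType) (A : set X).

Lemma continuous_set_type (f : T -> set_type A) :
  continuous (fun t => \val (f t)) -> continuous f.
Proof.
move=> cf t U [/= _ [[W oW <-] /= Wft] sWU].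
apply: filterS sWU _; apply: (cf t); apply: open_nbhs_nbhs; split => //.
Qed.

Lemma continuous_val : continuous (fun x : set_type A => \val x).
Proof. exact: (@initial_continuous _ _ (set_val : set_type A -> X)). Qed.

Lemma set_type_hausdorff : hausdorff_space X -> hausdorff_space (set_type A).
Proof.
move=> hX x y clxy; apply/val_inj/hX => U V nU nV.
have cv := @initial_continuous _ _ (set_val : set_type A -> X).
by case: (clxy _ _ (cv x _ nU) (cv y _ nV)) => z [Uz Vz]; exists (set_val z).
Qed.

Lemma set_type_compact : compact A -> compact [set: set_type A].
Proof.
move=> cA F FF _.
have cv := @initial_continuous _ _ (set_val : set_type A -> X).
have FA : (set_val @ F) A.
  by apply: (@filterS _ F _ setT) => [z _|]; [exact: set_valP|exact: filterT].
have [x [Ax clx]] := cA _ (fmap_proper_filter set_val FF) FA.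
exists (SigSub (mem_set Ax)); split => // B C FB [/= _ [[W oW <-] /= Wx] sWC].
have [||_ [[z Bz <-] Wz]] := clx (set_val @` B) W.
- by apply: (@filterS _ F _ B) FB => z Bz; exists z.
- exact: open_nbhs_nbhs.
by exists z; split => //; exact: sWC.
Qed.

End Subtype.

(** A continuous surjection from a compact to a Hausdorff space is closed: the preimage of a closed
    [C] under [g] is the image under [q] of a compact set. Hence [q] is a quotient map. *)
Lemma continuous_quotient (X Y Z : topologicalType) (q : X -> Y) (g : Y -> Z) :
  compact [set: X] -> hausdorff_space Y -> continuous q ->
  (forall y, exists x, q x = y) -> continuous (g \o q) -> continuous g.
Proof.
move=> cX hY cq sq cgq; apply/continuous_closedP => C cC.
have -> : g @^-1` C = q @` ((g \o q) @^-1` C).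
  apply/seteqP; split => [y Cy|_ [x Cx <-] //].
  by have [x qx] := sq y; exists x; rewrite //= qx.
apply: compact_closed => //; apply: continuous_compact.
  exact: continuous_subspaceT.
apply: subclosed_compact cX _ => //.
by move/continuous_closedP: cgq; apply.
Qed.

Lemma prod_hausdorff (X Y : topologicalType) :
  hausdorff_space X -> hausdorff_space Y -> hausdorff_space (X * Y)%type.
Proof.
move=> hX hY [x1 y1] [x2 y2] cl; congr pair.
- apply: hX => U V nU nV.
  have [||[a b] [/= ? ?]] := cl (fst @^-1` U) (fst @^-1` V).
  + exact: (@cvg_fst _ _ _ _ _ U nU).
  + exact: (@cvg_fst _ _ _ _ _ V nV).
  by exists a.
- apply: hY => U V nU nV.
  have [||[a b] [/= ? ?]] := cl (snd @^-1` U) (snd @^-1` V).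
  + exact: (@cvg_snd _ _ _ _ _ U nU).
  + exact: (@cvg_snd _ _ _ _ _ V nV).
  by exists b.
Qed.

Lemma continuous_compose (T X Y : topologicalType) (f : T -> X) (g : X -> Y) :
  continuous f -> continuous g -> continuous (fun t => g (f t)).
Proof. by move=> cf cg t; exact: (@continuous_comp _ _ _ f g t (cf t) (cg _)). Qed.

Lemma continuous_pair (T X Y : topologicalType) (f : T -> X) (g : T -> Y) :
  continuous f -> continuous g -> continuous (fun t => (f t, g t)).
Proof. by move=> cf cg t; apply: cvg_pair; [exact: cf|exact: cg]. Qed.

Lemma continuous_fst (X Y : topologicalType) : continuous (@fst X Y).
Proof. by move=> x; exact: cvg_fst. Qed.

Lemma continuous_snd (X Y : topologicalType) : continuous (@snd X Y).
Proof. by move=> x; exact: cvg_snd. Qed.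

(* Functoriality of the quotient: on the product with the unit interval, which
   is again compact, [q * id] is still a closed map. *)
Lemma homotopy_quotient (R : realType) (X Y Z : topologicalType) (q : X -> Y)
    (K : Y * R -> Z) :
  compact [set: X] -> hausdorff_space Y -> continuous q ->
  (forall y, exists x, q x = y) ->
  continuous (fun xs : X * R => K (q xs.1, xs.2)) ->
  {within [set: Y] `*` `[0, 1], continuous K}.
Proof.
move=> cX hY cq sq cK; apply/continuous_closedP => C cC.
apply/closed_subspaceP.
pose qi (xs : X * R) := (q xs.1, xs.2).
have cqi : continuous qi.
  apply: continuous_pair; last exact: continuous_snd.
  exact: (continuous_compose (@continuous_fst X R) cq).
pose D := ([set: X] `*` `[0 : R, 1]) `&` ((K \o qi) @^-1` C).
exists (qi @` D); last first.
  apply/seteqP; split => [_ [[[x s] [[/= _ s01] Cx] <-] _]|[y s] [Cy [_ s01]]].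
    by split.
  split => //; have [x qx] := sq y; exists (x, s); rewrite /qi /= ?qx //.
  by split => //=; rewrite /qi /= qx.
apply: compact_closed.
  by apply: prod_hausdorff => //; exact: Rhausdorff.
apply: continuous_compact; first exact: continuous_subspaceT.
apply: compact_closedI; first by apply: compact_setX => //; exact: segment_compact.
by move/continuous_closedP: cK; apply.
Qed.

(** * Simplices and collapses *)

Section Simplices.
Import mathcomp.boot.fintype mathcomp.boot.finset.
Variables (R : realType) (V : finType).
Implicit Types (F : {set {set V}}) (P Q : {set V}).
Local Notation E := {ptws V -> R}.

Definition vsupport (x : E) : {set V} := [set v | x v != 0]%SET.

Definition carried F (x : E) :=
  [/\ forall v, 0 <= x v, \sum_v x v = 1 & vsupport x \in F].

Definition down_closed F :=
  forall P Q, P \subset Q -> Q \in F -> P \in F.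

Definition vertex_point (p : V) : E := fun v => (v == p)%:R.

(** The default 1 is harmless for nonempty [P], since barycentric coordinates are at most 1. On a
    polyhedron the function is then positive exactly on the open star of [P]. *)
Definition min_on P (x : E) : R := \big[Num.min/1]_(v <- enum P) x v.

Lemma carried_le1 F x v : carried F x -> x v <= 1.
Proof.
case=> x0 <- _; rewrite (bigD1 v) //= lerDl.
by apply: sumr_ge0 => w _.
Qed.

Lemma continuous_min_on P : continuous (min_on P).
Proof.
apply: (@continuous_bigmin R E V (enum P) (fun=> 1) (fun v (x : E) => x v)).
  exact: continuous_cstR.
by move=> v; apply: (@continuous_coord R E V id v) => x; exact: cvg_id.
Qed.

Lemma min_on_le P x v : v \in P -> min_on P x <= x v.
Proof.
rewrite -mem_enum /min_on; elim: (enum P) => //= w r IH.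
rewrite inE big_cons ge_min => /predU1P[->|/IH ->]; first by rewrite lexx.
by rewrite orbT.
Qed.

Lemma min_on_cases P x :
  min_on P x = 1 \/ exists2 v, v \in P & min_on P x = x v.
Proof.
suff : min_on P x = 1 \/ exists2 v, v \in enum P & min_on P x = x v.
  by case=> [|[v]]; [left|rewrite mem_enum; right; exists v].
rewrite /min_on; elim: (enum P) => [|w r IH]; first by left; rewrite big_nil.
rewrite big_cons; case: leP => _; first by right; exists w; rewrite ?mem_head.
by case: IH => [|[v vr]]; [left|right; exists v; rewrite // inE vr orbT].
Qed.

Lemma min_on_ge0 P x : (forall v, 0 <= x v) -> 0 <= min_on P x.
Proof. by move=> x0; case: (min_on_cases P x) => [->|[v _ ->]]. Qed.

Lemma min_on_attained F P x : carried F x -> P != set0 ->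
  exists2 v, v \in P & min_on P x = x v.
Proof.
move=> Fx /set0Pn[w Pw]; case: (min_on_cases P x) => // m1; exists w => //.
by apply/eqP; rewrite eq_le min_on_le //= m1 (carried_le1 _ Fx).
Qed.

Lemma min_on_gt0 F P x : carried F x -> P != set0 ->
  (0 < min_on P x) = (P \subset vsupport x).
Proof.
move=> Fx P0; have [x0 _ _] := Fx; apply/idP/subsetP => [m0 v Pv|sP].
  by rewrite inE gt_eqF // (lt_le_trans m0) ?min_on_le.
have [v Pv ->] := min_on_attained Fx P0.
by have := sP v Pv; rewrite inE lt0r x0 andbT.
Qed.

Lemma carried_sub F F' x : F \subset F' -> carried F x -> carried F' x.
Proof. by move=> /subsetP sF [? ? ?]; split => //; exact: sF. Qed.

Lemma sum_vertex_point (p : V) : \sum_v vertex_point p v = 1.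
Proof.
rewrite (bigD1 p) //= big1 ?addr0 => [|v /negbTE vp].
  by rewrite /vertex_point eqxx.
by rewrite /vertex_point vp.
Qed.

(** A star step deletes all faces containing [P] at once; its hypothesis says that the link of [P]
    is a cone with apex [p]. The process ends at a cone. *)
Inductive collapsible : {set {set V}} -> Prop :=
| CollapsibleCone F p of set0 \in F & (forall Q, Q \in F -> p |: Q \in F) :
    collapsible F
| CollapsibleStar F P p of down_closed F & P != set0 & p \notin P &
    (forall Q, Q \in F -> P \subset Q -> p |: Q \in F) &
    collapsible [set Q in F | ~~ (P \subset Q)] :
    collapsible F.

(* The contraction is continuous on all of [R^V] and starts at the identity
   there, not only on the polyhedron of [F]. *)
Definition contracts F (c : E * R -> E) (a : E) :=
  [/\ continuous c, forall x, c (x, 0) = x,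
      forall x s, carried F x -> 0 <= s <= 1 -> carried F (c (x, s)),
      forall x, carried F x -> c (x, 1) = a & carried F a].

Lemma vertex_point_carried F p : [set p]%SET \in F -> carried F (vertex_point p).
Proof.
move=> Fp; split; [by move=> v; exact: ler0n|exact: sum_vertex_point|].
suff -> : vsupport (vertex_point p) = [set p]%SET by [].
by apply/setP => v; rewrite !inE pnatr_eq0 eqb0 negbK.
Qed.

Lemma cone_contracts F p : set0 \in F -> (forall Q, Q \in F -> p |: Q \in F) ->
  contracts F (fun xs v => (1 - xs.2) * xs.1 v + xs.2 * vertex_point p v)
    (vertex_point p).
Proof.
move=> F0 Fp.
have Ep : carried F (vertex_point p).
  by apply: vertex_point_carried; have := Fp _ F0; rewrite setU0.
split=> //.
- apply: continuous_ptws => v.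
  apply: continuous_addR; apply: continuous_mulR.
  + by apply: continuous_subR; [exact: continuous_cstR|exact: continuous_snd].
  + exact: (@continuous_coord R (E * R)%type V fst v (@continuous_fst _ _)).
  + exact: continuous_snd.
  + exact: continuous_cstR.
- by move=> x; apply/funext => v /=; rewrite subr0 mul1r mul0r addr0.
(* The endpoints are treated apart: strictly between them the support is exactly [p |: vsupport x],
   while at time 0 it is that of [x] and at time 1 it is [[set p]]. *)
- move=> x s Fx /andP[]; rewrite le_eqVlt => /predU1P[<- _|s0].
    suff -> : (fun v => (1 - 0) * x v + 0 * vertex_point p v) = x by [].
    by apply/funext => v /=; rewrite subr0 mul1r mul0r addr0.
  rewrite le_eqVlt => /predU1P[->|s1].
    suff -> : (fun v => (1 - 1) * x v + 1 * vertex_point p v) = vertex_point p.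
      by [].
    by apply/funext => v /=; rewrite subrr mul0r mul1r add0r.
  have [x0 x1 Fx'] := Fx; split => [v||].
  + by rewrite addr_ge0 ?mulr_ge0 ?ler0n ?subr_ge0 // ltW.
  + by rewrite big_split /= -!mulr_sumr x1 sum_vertex_point !mulr1 subrK.
  suff -> : vsupport (fun v => (1 - s) * x v + s * vertex_point p v) =
     p |: vsupport x by exact: Fp.
  apply/setP => v; rewrite !inE /vertex_point; have [->|vp] /= := eqVneq v p.
    by rewrite mulr1 gt_eqF // ltr_wpDl // mulr_ge0 // subr_ge0 ltW.
  by rewrite mulr0 addr0 mulf_eq0 negb_or subr_eq0 gt_eqF.
- by move=> x _; apply/funext => v /=; rewrite subrr mul0r mul1r add0r.
Qed.

(* Pushes the open star of [P] away from [P], towards [p]. *)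
Definition push P p (xs : E * R) : E := fun v =>
  xs.1 v + xs.2 * min_on P xs.1 * (#|P|%:R * vertex_point p v - (v \in P)%:R).

Lemma continuous_push P p : continuous (push P p).
Proof.
apply: continuous_ptws => v; apply: continuous_addR.
  exact: (@continuous_coord R (E * R)%type V fst v (@continuous_fst _ _)).
apply: continuous_mulR; last exact: continuous_cstR.
apply: continuous_mulR; first exact: continuous_snd.
exact: (continuous_compose (@continuous_fst E R) (@continuous_min_on P)).
Qed.

Lemma push0 P p x : push P p (x, 0) = x.
Proof. by apply/funext => v; rewrite /push /= !mul0r addr0. Qed.

(** What is taken from each of the [#|P|] vertices of [P] is handed to [p]. *)
Lemma sum_push P p x s : \sum_v push P p (x, s) v = \sum_v x v.
Proof.
rewrite /push big_split /= -mulr_sumr sumrB -mulr_sumr sum_vertex_point mulr1.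
have -> : \sum_v (v \in P)%:R = #|P|%:R :> R.
  by rewrite -sum1_card natr_sum [RHS]big_mkcond; apply: eq_bigr => v _; case: ifP.
by rewrite subrr mulr0 addr0.
Qed.

Lemma push_ge0 P p x s : p \notin P -> (forall v, 0 <= x v) -> 0 <= s <= 1 ->
  forall v, 0 <= push P p (x, s) v.
Proof.
move=> pP x0 /andP[s0 s1] v; rewrite /push /=.
have m0 := min_on_ge0 P x0.
case: (boolP (v \in P)) => vP.
  have -> : vertex_point p v = 0.
    by rewrite /vertex_point; case: eqP vP pP => // -> ->.
  rewrite mulr0 sub0r mulrN1 subr_ge0.
  by apply: le_trans (min_on_le x vP); rewrite ler_piMl.
by rewrite subr0 addr_ge0 ?mulr_ge0 ?ler0n.
Qed.

Lemma push_fixed P p x s : min_on P x = 0 -> push P p (x, s) = x.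
Proof. by move=> m0; apply/funext => v; rewrite /push /= m0 mulr0 mul0r addr0. Qed.

Lemma support_push P p x s : vsupport (push P p (x, s)) \subset
  if min_on P x == 0 then vsupport x else p |: (vsupport x :|: P).
Proof.
case: eqP => [/push_fixed -> //|_]; apply/subsetP => v; rewrite !inE /push /=.
case: (boolP (v \in P)) => [_|_]; first by rewrite !orbT.
rewrite /vertex_point; case: (v == p) => //=.
by rewrite orbF mulr0 subr0 mulr0 addr0.
Qed.

Section Star.
Variables (F : {set {set V}}) (P : {set V}) (p : V).
Hypotheses (dF : down_closed F) (P0 : P != set0) (pP : p \notin P)
  (starF : forall Q, Q \in F -> P \subset Q -> p |: Q \in F).

(** Either the minimum over [P] vanishes and nothing moves, or [P] lies in the support, so that
    [starF] allows the vertex [p] to be added. *)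
Lemma push_carried x s : carried F x -> 0 <= s <= 1 -> carried F (push P p (x, s)).
Proof.
move=> Fx s01; have [x0 x1 sx] := Fx; split; first exact: push_ge0.
  by rewrite sum_push.
apply: dF (support_push P p x s) _; case: eqP => // /eqP m0.
have sP : P \subset vsupport x by rewrite -(min_on_gt0 Fx P0) lt0r m0 min_on_ge0.
by rewrite (setUidPl sP); exact: starF.
Qed.

(** At time 1 the vertex of [P] at which the minimum is attained loses all its mass, so the support
    no longer contains [P]. *)
Lemma push1_carried x : carried F x ->
  carried [set Q in F | ~~ (P \subset Q)] (push P p (x, 1)).
Proof.
move=> Fx; have [|y0 y1 sy] := @push_carried x 1 Fx; first by rewrite ler01 lexx.
split=> //; rewrite inE sy /=; apply/subsetPn.
have [v Pv mv] := min_on_attained Fx P0; exists v => //.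
have pv : vertex_point p v = 0.
  by rewrite /vertex_point; case: eqP Pv pP => // -> ->.
by rewrite inE negbK /push /= pv Pv mv mulr0 sub0r mul1r mulrN1 subrr.
Qed.

(** The push takes the first half of the time and [c] the second. Reparametrizing with [min] and
    [max] makes the concatenation a single composite, with no gluing of two continuous pieces. *)
Lemma star_contracts c a : contracts [set Q in F | ~~ (P \subset Q)] c a ->
  contracts F (fun xs => c (push P p (xs.1, Num.min 1 (2 * xs.2)),
                            Num.max 0 (2 * xs.2 - 1))) a.
Proof.
move=> [cc c0 Fc c1 Fa].
have sF : [set Q in F | ~~ (P \subset Q)] \subset F.
  by apply/subsetP => Q; rewrite inE => /andP[].
have c2 : continuous (fun xs : E * R => 2 * xs.2 : R).
  by apply: continuous_mulR; [exact: continuous_cstR|exact: continuous_snd].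
split=> //.
- apply: (@continuous_compose _ _ _ (fun xs : E * R =>
    (push P p (xs.1, Num.min 1 (2 * xs.2)), Num.max 0 (2 * xs.2 - 1))) c) => //.
  apply: continuous_pair.
    apply: (@continuous_compose _ _ _ (fun xs : E * R =>
      (xs.1, Num.min 1 (2 * xs.2)))); last exact: continuous_push.
    apply: continuous_pair; first exact: continuous_fst.
    by apply: continuous_minR => //; exact: continuous_cstR.
  apply: continuous_maxR; first exact: continuous_cstR.
  by apply: continuous_subR => //; exact: continuous_cstR.
- move=> x /=; rewrite mulr0 sub0r (min_idPr ler01) push0.
  by rewrite (max_idPl _) ?c0 // oppr_le0 ler01.
- move=> x s Fx /andP[s0 s1] /=.
  (* In the first half [c] stands at time 0, where it is the identity on all of [R^V], even at
     points outside the smaller complex. *)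
  have [s2|s2] := leP (2 * s) 1.
    have -> : Num.max 0 (2 * s - 1) = 0 by apply/max_idPl; rewrite subr_le0.
    by rewrite c0; apply: push_carried => //; apply/andP; split=> //; lra.
  have -> : Num.max 0 (2 * s - 1) = 2 * s - 1 by apply/max_idPr; lra.
  apply: (carried_sub sF); apply: Fc; first exact: push1_carried.
  by apply/andP; split; lra.
- move=> x Fx /=; rewrite mulr1.
  have -> : Num.min 1 (2 : R) = 1 by apply/min_idPl; lra.
  have -> : Num.max 0 (2 - 1 : R) = 1 by rewrite max_r; lra.
  by rewrite c1 //; exact: push1_carried.
- exact: carried_sub sF Fa.
Qed.

End Star.

Lemma collapsible_contracts F : collapsible F -> exists c a, contracts F c a.
Proof.
elim=> [{}F p F0 Fp|{}F P p dF P0 pP sF _ [c [a cF]]].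
  by do 2 eexists; exact: (cone_contracts F0 Fp).
by do 2 eexists; exact: (star_contracts dF P0 pP sF cF).
Qed.

End Simplices.

(** * Simplices modulo their boundary *)

Section SimplexToSphere.
Import mathcomp.boot.fintype mathcomp.boot.finset.
Variables (R : realType) (V : finType) (d : nat) (e : 'I_d.+1 -> V).
Hypothesis e_inj : injective e.
Local Notation E := {ptws V -> R}.
Implicit Types x : E.

Local Notation face := (e @: [set: 'I_d.+1])%SET.

Definition spread x : R := \sum_i (x (e i) - x (e ord0)) ^+ 2.
Definition defect x : R := 1 - \sum_i x (e i).
Definition denom x : R := spread x + defect x ^+ 2 + min_on face x ^+ 2.

(* On the open simplex, [x |-> (x (e i) - x (e 0)) / min x] is a homeomorphism
   onto R^d; this is its composite with the inverse stereographic projection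
   from the base point.  The defect vanishes there, and keeps the denominator
   positive away from the simplex. *)
Definition to_sphere x : 'rV[R]_d.+1 := \row_i
  ((if i == ord0 then spread x + defect x ^+ 2 - min_on face x ^+ 2
    else 2 * min_on face x * (x (e i) - x (e ord0))) / denom x).

Lemma mem_face i : e i \in face.
Proof. by apply/imsetP; exists i. Qed.

Lemma face_neq0 : face != set0.
Proof. by apply/set0Pn; exists (e ord0); exact: mem_face. Qed.

Lemma spread_ge0 x : 0 <= spread x.
Proof. by apply: sumr_ge0 => i _; exact: sqr_ge0. Qed.

(** If all three terms vanished, the coordinates on the face would be equal with minimum 0, hence
    all zero, and the defect would be 1. *)
Lemma denom_gt0 x : 0 < denom x.
Proof.
have s0 := spread_ge0 x; have d0 := sqr_ge0 (defect x).
have m0 := sqr_ge0 (min_on face x).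
rewrite lt0r !addr_ge0 // andbT; apply/eqP => D0.
have [S0 [F0 M0]] : spread x = 0 /\ defect x ^+ 2 = 0 /\ min_on face x ^+ 2 = 0.
  by rewrite /denom in D0; do !split; lra.
have xE i : x (e i) = x (e ord0).
  apply/eqP; rewrite -subr_eq0 -(sqrf_eq0 (_ - _)).
  move/eqP: S0.
  rewrite psumr_eq0 => [/allP /(_ i (mem_index_enum _)) //|j _].
  exact: sqr_ge0.
move/eqP: M0; rewrite sqrf_eq0 => /eqP.
case: (min_on_cases face x) => [->|[_ /imsetP[i _ ->] ->]].
  by move/eqP; rewrite oner_eq0.
rewrite xE => x0; move/eqP: F0; rewrite sqrf_eq0 /defect.
by rewrite big1 ?subr0 ?oner_eq0 // => j _; rewrite xE.
Qed.

Lemma continuous_to_sphere : continuous to_sphere.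
Proof.
have cp v : continuous (fun x : E => x v).
  by apply: (@continuous_coord R E V id v) => x; exact: cvg_id.
have cm : continuous (min_on face : E -> R) := @continuous_min_on R V face.
have c2 (f : E -> R) : continuous f -> continuous (fun x => f x ^+ 2).
  by move=> cf; exact: (@continuous_mulR R E f f cf cf).
have cS : continuous spread.
  by apply: continuous_sum => i; apply: c2; exact: continuous_subR.
have cF : continuous (fun x => defect x ^+ 2).
  apply: c2; apply: continuous_subR; first exact: continuous_cstR.
  exact: continuous_sum.
have cD : continuous (fun x => (denom x)^-1).
  apply: continuous_invR => [x|]; first by rewrite gt_eqF ?denom_gt0.
  by apply: continuous_addR; [exact: continuous_addR|exact: c2].
apply: continuous_row => i.
rewrite (_ : (fun x => _) = fun x => (if i == ord0 then
    spread x + defect x ^+ 2 - min_on face x ^+ 2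
  else 2 * min_on face x * (x (e i) - x (e ord0))) * (denom x)^-1); last first.
  by apply/funext => x; rewrite mxE.
apply: continuous_mulR => //; case: eqP => _.
  by apply: continuous_subR; [exact: continuous_addR|exact: c2].
apply: continuous_mulR; last exact: continuous_subR.
by apply: continuous_mulR => //; exact: continuous_cstR.
Qed.

Lemma to_sphere_base x : min_on face x = 0 -> to_sphere x = delta_mx ord0 ord0.
Proof.
move=> m0; apply/rowP => i; rewrite !mxE eqxx /=; case: eqP => _ /=.
  have := denom_gt0 x; rewrite /denom m0 expr0n /= addr0 subr0 => D0.
  by rewrite divff // gt_eqF.
by rewrite m0 mulr0 mul0r mul0r.
Qed.

Lemma spreadE x : spread x = \sum_(i | i != ord0) (x (e i) - x (e ord0)) ^+ 2.
Proof. by rewrite /spread (bigD1 ord0) //= subrr expr0n /= add0r. Qed.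

(** With [S], [F], [m] for spread, defect and minimum, this is the identity [(S + F^2 - m^2)^2 + 4
    m^2 S - (S + F^2 + m^2)^2 = - 4 m^2 F^2]. *)
Lemma to_sphere_unit x : min_on face x * defect x = 0 -> unit_vector (to_sphere x).
Proof.
move=> md; have D0 : denom x != 0 by rewrite gt_eqF ?denom_gt0.
rewrite /unit_vector (bigD1 ord0) //= mxE eqxx.
have -> : \sum_(i < d.+1 | i != ord0) to_sphere x ord0 i ^+ 2 =
    (2 * min_on face x / denom x) ^+ 2 * spread x.
  rewrite spreadE mulr_sumr; apply: eq_bigr => i /negbTE i0.
  by rewrite mxE i0 -exprMn; congr (_ ^+ 2); ring.
move: D0; rewrite /denom.
set S := spread x; set F := defect x; set m := min_on face x => D0.
have mF : m ^+ 2 * F ^+ 2 = 0 by rewrite -exprMn md expr0n.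
have -> : (2 * m / (S + F ^+ 2 + m ^+ 2)) ^+ 2 * S =
    (2 * m) ^+ 2 * S / (S + F ^+ 2 + m ^+ 2) ^+ 2 by field.
rewrite expr_div_n -mulrDl; apply: (canLR (mulfK _)); first by rewrite expf_neq0.
rewrite mul1r; apply/eqP; rewrite -subr_eq0; apply/eqP.
transitivity (- 4 * (m ^+ 2 * F ^+ 2)); first by ring.
by rewrite mF mulr0.
Qed.

Lemma sum_over_face x : (forall v, v \notin face -> x v = 0) ->
  \sum_v x v = \sum_i x (e i).
Proof.
move=> x0; rewrite (bigID [in face]) /= [X in _ + X]big1 ?addr0 //.
rewrite big_imset /=; last by move=> i j _ _; exact: e_inj.
by apply: eq_bigl => i; rewrite inE.
Qed.

Section OpenSimplex.
Variable x : E.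
Hypothesis Fx : carried [set face] x.

Let sx : vsupport x = face.
Proof. by case: Fx => _ _ /set1P. Qed.

Lemma sum_open_simplex : \sum_i x (e i) = 1.
Proof.
case: Fx => _ <- _; rewrite sum_over_face // => v.
by rewrite -sx inE negbK => /eqP.
Qed.

Lemma open_simplex_defect : defect x = 0.
Proof. by rewrite /defect sum_open_simplex subrr. Qed.

Lemma open_simplex_min_gt0 : 0 < min_on face x.
Proof. by rewrite (min_on_gt0 Fx face_neq0) sx. Qed.

Lemma open_simplex_min_attained : exists i, min_on face x = x (e i).
Proof.
by have [_ /imsetP[i _ ->] ->] := min_on_attained Fx face_neq0; exists i.
Qed.

Lemma to_sphere0 :
  1 - to_sphere x ord0 ord0 = 2 * min_on face x ^+ 2 / denom x.
Proof.
have D0 : denom x != 0 by rewrite gt_eqF ?denom_gt0.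
rewrite mxE eqxx; apply: (mulIf D0); rewrite mulfVK // mulrBl mulfVK // /denom.
by rewrite open_simplex_defect; ring.
Qed.

Lemma to_sphere_neq_base : to_sphere x != delta_mx ord0 ord0.
Proof.
apply/eqP => E0; have := to_sphere0; rewrite E0 mxE !eqxx /= subrr => /esym/eqP.
rewrite gt_eqF // divr_gt0 ?denom_gt0 // mulr_gt0 //.
by rewrite exprn_gt0 // open_simplex_min_gt0.
Qed.

Lemma stereographic_to_sphere i : i != ord0 ->
  to_sphere x ord0 i / (1 - to_sphere x ord0 ord0) =
  (x (e i) - x (e ord0)) / min_on face x.
Proof.
move=> /negbTE i0; rewrite to_sphere0 mxE i0.
have D0 : denom x != 0 by rewrite gt_eqF ?denom_gt0.
have m0 : min_on face x != 0 by rewrite gt_eqF ?open_simplex_min_gt0.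
by field; rewrite D0 m0.
Qed.

End OpenSimplex.

(** Equal stereographic coordinates make [y] an affine function [k x + c] of [x] on the face, with
    [k] the ratio of the minima. Comparing minima gives [c = 0], comparing sums gives [k = 1]. *)
Lemma to_sphere_inj x y : carried [set face] x -> carried [set face] y ->
  to_sphere x = to_sphere y -> x = y.
Proof.
move=> Fx Fy xy.
have mx := open_simplex_min_gt0 Fx; have my := open_simplex_min_gt0 Fy.
pose k := min_on face y / min_on face x.
have k0 : 0 < k by exact: divr_gt0.
have ky : min_on face y = k * min_on face x by rewrite /k mulfVK // gt_eqF.
pose c := y (e ord0) - k * x (e ord0).
have yE i : y (e i) = k * x (e i) + c.
  have [->|i0] := eqVneq i ord0; first by rewrite /c; ring.
  have := stereographic_to_sphere Fx i0.
  rewrite xy (stereographic_to_sphere Fy i0) => /(canRL (mulfVK _)).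
  rewrite gt_eqF // => /(_ isT); rewrite ky => h.
  rewrite /c; apply/eqP; rewrite -subr_eq0; apply/eqP.
  transitivity (y (e i) - y (e ord0) - k * (x (e i) - x (e ord0))); first by ring.
  by rewrite h; field; rewrite gt_eqF.
have c0 : c = 0.
  apply/eqP; rewrite eq_le; apply/andP; split.
    have [j yj] := open_simplex_min_attained Fy.
    have := min_on_le x (mem_face j); rewrite -(ler_pM2l k0) -ky yj yE.
    by rewrite gerDl.
  have [j xj] := open_simplex_min_attained Fx.
  have := min_on_le y (mem_face j); rewrite yE ky xj.
  by rewrite lerDl.
have k1 : k = 1.
  have := sum_open_simplex Fy; under eq_bigr do rewrite yE c0 addr0.
  by rewrite -mulr_sumr (sum_open_simplex Fx) mulr1.
have offface (z : E) v : carried [set face] z -> v \notin face -> z v = 0.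
  by case=> _ _ /set1P <-; rewrite inE negbK => /eqP.
apply/funext => v; case: (boolP (v \in face)) => [/imsetP[i _ ->]|vf].
  by rewrite yE k1 c0 mul1r addr0.
by rewrite !offface.
Qed.

(** The preimage is built from the stereographic coordinates [z] of [y]: they are shifted to have
    minimum 1 and divided by their sum [T], so that the minimum of the resulting point is [T^-1]. *)
Lemma to_sphere_surj (y : 'rV[R]_d.+1) :
  unit_vector y -> y != delta_mx ord0 ord0 ->
  exists2 x, carried [set face] x & to_sphere x = y.
Proof.
move=> uy yb; pose a := y ord0 ord0.
pose S := \sum_(i < d.+1 | i != ord0) y ord0 i ^+ 2.
have aS : a ^+ 2 + S = 1 by rewrite -uy (bigD1 ord0).
have S0 : 0 <= S by apply: sumr_ge0 => i _; exact: sqr_ge0.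
have a1 : 0 < 1 - a.
  rewrite subr_gt0 lt_neqAle; apply/andP; split; last by nra.
  apply: contra_neq yb => a1; have {}S0 : S = 0 by rewrite a1 in aS; lra.
  apply/rowP => i; rewrite mxE eqxx /=; have [->|i0] := eqVneq i ord0 => //.
  apply/eqP; rewrite -sqrf_eq0; move/eqP: S0.
  rewrite psumr_eq0 => [/allP /(_ i (mem_index_enum _))|j _]; last exact: sqr_ge0.
  by rewrite i0.
pose z i := if i == ord0 then 0 else y ord0 i / (1 - a).
(* The default 0 is itself a value of [z], namely at [ord0]. *)
pose m := \big[Num.min/0]_i z i.
have mz i : m <= z i by rewrite /m; exact: bigmin_le_cond.
have [i0 zi0] : exists i, z i = m.
  have : m \in 0 :: [seq z i | i <- index_enum 'I_d.+1].
    rewrite /m; elim: (index_enum _) => [|j r IH]; first by rewrite big_nil mem_head.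
    rewrite big_cons; case: leP => _; first by rewrite !inE eqxx orbT.
    by move: IH; rewrite !inE => /orP[->|->] //; rewrite !orbT.
  rewrite inE => /predU1P[->|/mapP[i _ ->]]; last by exists i.
  by exists ord0; rewrite /z eqxx.
pose T := \sum_i (1 + z i - m).
have T0 : 0 < T.
  rewrite /T (bigD1 ord0) //= ltr_pwDl //.
    by have := mz ord0; lra.
  by apply: sumr_ge0 => i _; have := mz i; lra.
(* Extension by zero off the face: by injectivity of [e] at most one term of the sum is nonzero. *)
pose x : E := fun v => \sum_i (e i == v)%:R * (T^-1 * (1 + z i - m)).
have xe i : x (e i) = T^-1 * (1 + z i - m).
  rewrite /x (bigD1 i) //= eqxx mul1r big1 ?addr0 // => j /negbTE ji.
  by rewrite (inj_eq e_inj) ji mul0r.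
have xoff v : v \notin face -> x v = 0.
  move=> vf; rewrite /x big1 // => i _; case: eqP vf => [<-|_ _].
    by rewrite mem_face.
  by rewrite mul0r.
have xe0 i : 0 < x (e i).
  by rewrite xe mulr_gt0 ?invr_gt0 //; have := mz i; lra.
have Fx : carried [set face] x.
  split.
  - move=> v; case: (boolP (v \in face)) => [/imsetP[i _ ->]|/xoff -> //].
    exact: ltW.
  - rewrite sum_over_face //; under eq_bigr do rewrite xe.
    by rewrite -mulr_sumr mulVf // gt_eqF.
  - apply/set1P/setP => v; rewrite inE.
    case: (boolP (v \in face)) => [/imsetP[i _ ->]|/xoff ->]; last by rewrite eqxx.
    by rewrite gt_eqF.
exists x => //.
have mE : min_on face x = T^-1.
  apply/eqP; rewrite eq_le; apply/andP; split.
    apply: le_trans (min_on_le x (mem_face i0)) _.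
    by rewrite xe zi0 addrK mulr1.
  have [i ->] := open_simplex_min_attained Fx; rewrite xe ler_peMr //.
    by rewrite invr_ge0 ltW.
  by have := mz i; lra.
have z0 : z ord0 = 0 by rewrite /z eqxx.
have dE i : x (e i) - x (e ord0) = T^-1 * z i by rewrite !xe z0; ring.
have sE : spread x = T^-1 ^+ 2 * (S / (1 - a) ^+ 2).
  rewrite spreadE /S mulr_suml mulr_sumr; apply: eq_bigr => i /negbTE ni.
  by rewrite dE exprMn {1}/z ni expr_div_n.
have SE : S = (1 - a) * (1 + a) by transitivity (1 - a ^+ 2); [lra|ring].
have DE : denom x = T^-1 ^+ 2 * (2 / (1 - a)).
  rewrite /denom sE (open_simplex_defect Fx) mE SE.
  by field; rewrite !gt_eqF.
apply/rowP => i; rewrite mxE DE; case: eqP => [->|/eqP/negbTE ni].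
  rewrite sE (open_simplex_defect Fx) mE SE -/a.
  by field; rewrite !gt_eqF.
rewrite mE dE /z ni.
by field; rewrite !gt_eqF.
Qed.

End SimplexToSphere.

(** * Collapsing a contractible subcomplex *)

Section WedgeLift.
Variables (I : choiceType) (X : I -> topologicalType) (p : forall i, X i).

Lemma wedge_lift_inj i : injective (@wedge_lift I X p i).
Proof.
move=> a b /eqmodP/predU1P[E|/andP[/eqP /= -> /eqP /= -> //]].
exact: (existT_inj2 E).
Qed.

Lemma wedge_lift_neq i j (a : X i) (b : X j) : i != j ->
  wedge_lift p a = wedge_lift p b -> a = p i.
Proof.
move=> ij /eqmodP/predU1P[E|/andP[/eqP //]].
by rewrite (existT_inj1 E) eqxx in ij.
Qed.

End WedgeLift.

(** * The collapse map onto the wedge of spheres *)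

Section Quotient.
Variables (R : realType) (K : scomplex) (J : finType) (d : J -> nat).
Variable e : forall j, 'I_(d j).+1 -> K.
Arguments e : clear implicits.
Hypothesis e_inj : forall j, injective (e j).
Arguments e_inj : clear implicits.
Local Notation E := {ptws K -> R}.
Local Notation F := (faces K).

Local Notation face j := (e j @: [set: 'I_(d j).+1])%SET.

Hypothesis face_F : forall j, face j \in F.
Hypothesis face_max : forall j Q, Q \in F -> face j \subset Q -> Q = face j.
Hypothesis face_inj : forall i j, face i = face j -> i = j.

Local Notation A := [set Q in F | [forall j, Q != face j]]%SET.
Local Notation X := (realization R K).
Local Notation Y :=
  (@wedge J (fun j => sphere R (d j)) (fun j => sphere_base R (d j))).
Local Notation into_wedge j :=
  (@wedge_lift J (fun j => sphere R (d j)) (fun j => sphere_base R (d j)) j).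

Variable j0 : J.

Local Notation M j x := (min_on (face j) x).

Lemma realization_carried (x : X) : carried F (\val x).
Proof. exact: (set_valP x). Qed.

(** The open star of a facet is its open simplex. *)
Lemma min_gt0P j (x : E) : carried F x -> 0 < M j x -> vsupport x = face j.
Proof.
move=> Fx; rewrite (min_on_gt0 Fx (@face_neq0 K (d j) (e j))) => sP.
by apply: face_max sP; case: Fx.
Qed.

Lemma min_eq0 j (x : E) : carried F x -> vsupport x != face j -> M j x = 0.
Proof.
move=> Fx ns; apply/eqP; apply/negPn/negP => m0; case/eqP: ns.
by apply: min_gt0P => //; rewrite lt0r m0 min_on_ge0 //; case: Fx.
Qed.

Lemma min_unique i j (x : E) : carried F x -> 0 < M j x -> i != j -> M i x = 0.
Proof.
move=> Fx mj ij; apply: min_eq0 => //; rewrite (min_gt0P Fx mj).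
by apply: contra_neq ij => /face_inj.
Qed.

Lemma carried_nonface (x : E) : carried F x ->
  (carried A x <-> forall j, M j x = 0).
Proof.
move=> Fx; split => [[x0 _]|m0].
  rewrite inE => /andP[_ /forallP nf] j; exact: min_eq0.
have [x0 x1 sx] := Fx; split => //; rewrite inE sx /=; apply/forallP => j.
apply/eqP => sj; have := min_on_gt0 Fx (@face_neq0 K (d j) (e j)).
by rewrite sj m0 ltxx fintype.subxx.
Qed.

(** Off the open simplex the minimum vanishes, and on it the defect does; in both cases
    [to_sphere_unit] applies. *)
Lemma sphere_coordP j (x : X) :
  to_sphere (e j) (\val x) \in [set y : 'rV[R]_(d j).+1 | unit_vector y].
Proof.
have Fx := realization_carried x; apply/mem_set/to_sphere_unit.
have [m0|m0] := leP (M j (\val x)) 0.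
  by rewrite (@le_anti _ R (M j (\val x)) 0) ?mul0r // m0 min_on_ge0 //; case: Fx.
rewrite (open_simplex_defect (@e_inj j)) ?mulr0 //.
by case: (Fx) => ? ? _; split => //; apply/set1P; exact: min_gt0P.
Qed.

Definition sphere_coord j (x : X) : sphere R (d j) := SigSub (sphere_coordP j x).

Lemma continuous_sphere_coord j : continuous (sphere_coord j).
Proof.
apply: continuous_set_type => /=.
apply: (@continuous_compose _ _ _ (fun x : X => \val x)).
  exact: continuous_val.
exact: continuous_to_sphere.
Qed.

(** Each open critical simplex wraps around its own sphere; the rest goes to the wedge point, which
    is written here as the base point of the sphere [j0]. *)
Definition collapse (x : X) : Y :=
  if [pick j | 0 < M j (\val x)] is Some j then into_wedge j (sphere_coord j x)
  else into_wedge j0 (sphere_base R (d j0)).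

Lemma collapse_open j (x : X) : 0 < M j (\val x) ->
  collapse x = into_wedge j (sphere_coord j x).
Proof.
move=> mj; rewrite /collapse; case: pickP => [i mi|/(_ j)]; last by rewrite mj.
have [-> //|ij] := eqVneq i j.
by move: mi; rewrite (min_unique (realization_carried x) mj ij) ltxx.
Qed.

Lemma collapse_nonface (x : X) : carried A (\val x) ->
  collapse x = into_wedge j0 (sphere_base R (d j0)).
Proof.
move/(carried_nonface (realization_carried x)) => m0.
by rewrite /collapse; case: pickP => // i; rewrite m0 ltxx.
Qed.

Lemma sphere_coord_base j (x : X) : M j (\val x) = 0 ->
  sphere_coord j x = sphere_base R (d j).
Proof. by move=> m0; apply/val_inj/to_sphere_base. Qed.

Lemma nonface_or_open (x : E) : carried F x ->
  carried A x \/ exists j, 0 < M j x.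
Proof.
move=> Fx; case: (pselect (exists j, 0 < M j x)) => [|nm]; first by right.
left; apply/(carried_nonface Fx) => j; apply/eqP; rewrite eq_le min_on_ge0 ?andbT.
  by rewrite leNgt; apply/negP => mj; apply: nm; exists j.
by case: Fx.
Qed.

(** At a point of the subcomplex all of the finitely many sphere coordinates are at their base
    points, and a neighbourhood of the wedge point restricts to neighbourhoods of all of these. In
    an open simplex the minimum stays positive nearby, so the map is locally one sphere
    coordinate. *)
Lemma continuous_collapse : continuous collapse.
Proof.
move=> x; have Fx := realization_carried x.
case: (nonface_or_open Fx) => [Ax|[j mj]] U.
  rewrite collapse_nonface // wedge_point_nbhs => nU.
  have nN : \forall z \near x, forall j, U (into_wedge j (sphere_coord j z)).
    apply: (@filter_forall _ _ (fun j z => U (into_wedge j (sphere_coord j z)))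
      (nbhs x) (nbhs_filter x)).
    move=> j; move/(carried_nonface Fx) : Ax => m0.
    apply: (@continuous_sphere_coord j x (into_wedge j @^-1` U)).
    by rewrite sphere_coord_base //; exact: nU.
  apply: (@filterS _ (nbhs x) (nbhs_filter x) _ _ _ nN) => z Uz.
  case: (nonface_or_open (realization_carried z)).
    move=> Az; rewrite /= collapse_nonface //.
    have := nU j0 Logic.I => nb; exact: (nbhs_singleton nb).
  by case=> i mi; rewrite /= (collapse_open mi).
rewrite (collapse_open mj) => nU.
have nV : nbhs x [set z : X | U (into_wedge j (sphere_coord j z))].
  apply: (@continuous_sphere_coord j x (into_wedge j @^-1` U)).
  exact: (wedge_lift_continuous nU).
have nM : nbhs x [set z : X | 0 < M j (\val z)].
  have cM : continuous (fun z : X => M j (\val z)).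
    apply: (@continuous_compose _ _ _ (fun x : X => \val x)).
      exact: continuous_val.
    exact: continuous_min_on.
  by apply: (cM x [set r | 0 < r]); apply: open_nbhs_nbhs; split.
apply: (@filterS _ (nbhs x) (nbhs_filter x) _ _ _ (filterI nV nM)).
by move=> z [/= Uz mz]; rewrite (collapse_open mz).
Qed.

Lemma open_carried_face j (x : X) : 0 < M j (\val x) ->
  carried [set face j]%SET (\val x).
Proof.
move=> mj; have Fx := realization_carried x.
by have [? ? _] := Fx; split => //; apply/finset.set1P; exact: min_gt0P.
Qed.

Lemma sphere_coord_neq_base j (x : X) : 0 < M j (\val x) ->
  sphere_coord j x <> sphere_base R (d j).
Proof.
move=> mj /(congr1 val) /= /eqP; apply/negP.
by apply: to_sphere_neq_base => //; exact: open_carried_face.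
Qed.

Lemma collapse_open_neq j (x y : X) : 0 < M j (\val x) -> carried A (\val y) ->
  collapse x <> collapse y.
Proof.
move=> mj Ay; rewrite (collapse_open mj) (collapse_nonface Ay) => E0.
apply: (sphere_coord_neq_base mj); have [jj|jj] := eqVneq j j0.
  by subst j; exact: (wedge_lift_inj E0).
exact: (wedge_lift_neq jj E0).
Qed.

(** On an open simplex [to_sphere] is injective and avoids the base point, so the only nontrivial
    fibre is the one over the wedge point. *)
Lemma collapse_eq (x y : X) : collapse x = collapse y ->
  x = y \/ carried A (\val x) /\ carried A (\val y).
Proof.
case: (nonface_or_open (realization_carried x)) => [Ax|[i mi]];
  case: (nonface_or_open (realization_carried y)) => [Ay|[j mj]].
- by right.
- by move/esym/(collapse_open_neq mj Ax).
- by move/(collapse_open_neq mi Ay).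
- rewrite (collapse_open mi) (collapse_open mj) => E0; left.
  have [ij|ij] := eqVneq i j; last first.
    by have /(sphere_coord_neq_base mi) := wedge_lift_neq ij E0.
  subst j; have /(congr1 val) /= := wedge_lift_inj E0.
  move=> h; apply: val_inj; apply: (@to_sphere_inj _ _ _ (e i)) h => //;
    exact: open_carried_face.
Qed.

Lemma carried_realization (x : E) : carried F x -> exists y : X, \val y = x.
Proof. by move=> Fx; exists (SigSub (mem_set (Fx : [set x | barycentric x] x))). Qed.

(** The hypothesis supplies a preimage of the wedge point; every other point comes from an open
    simplex through [to_sphere_surj]. *)
Lemma collapse_surj : (exists x : E, carried A x) ->
  forall y : Y, exists x, collapse x = y.
Proof.
move=> [a Aa] y.
have sAF : A \subset F by apply/fintype.subsetP => Q; rewrite inE => /andP[].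
have [j [b <-]] : exists j (b : sphere R (d j)), into_wedge j b = y.
  have : [set: Y] y by [].
  by rewrite -wedgeTE => -[j _ [b _ <-]]; exists j, b.
have [bb|bb] := eqVneq b (sphere_base R (d j)).
  have [x xa] := carried_realization (carried_sub sAF Aa).
  exists x; rewrite collapse_nonface ?xa // bb;
  exact: (@wedge_liftE _ _ _ j (sphere_base R (d j)) j0 (sphere_base R (d j0))).
have ub : unit_vector (\val b) by exact: (set_valP b).
have [|x Fx xb] := to_sphere_surj (@e_inj j) ub.
  by apply: contra_neq bb => h; apply: val_inj.
have sF : [set face j]%SET \subset F by rewrite finset.sub1set.
have [z zx] := carried_realization (carried_sub sF Fx).
have mj : 0 < M j (\val z) by rewrite zx; exact: open_simplex_min_gt0.
exists z; rewrite (collapse_open mj); congr wedge_lift; apply: val_inj.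
by rewrite /= zx.
Qed.

Lemma sphere_hausdorff n : hausdorff_space (sphere R n).
Proof. by apply: set_type_hausdorff; exact: norm_hausdorff. Qed.

Lemma wedge_spheres_hausdorff : hausdorff_space Y.
Proof. by apply: wedge_hausdorff => j; exact: sphere_hausdorff. Qed.

(** The realization is a closed subset of a cube. The support condition is closed because it says
    that the minimum over every non-face is at most 0. *)
Lemma realization_compact : compact [set: X].
Proof.
apply: set_type_compact.
have cp v : continuous (fun x : E => x v).
  by apply: (@continuous_coord R E K id v) => x; exact: cvg_id.
pose I01 : set R := `[0, 1]%classic.
have I01E r : I01 r = (0 <= r <= 1) by rewrite /I01 /= in_itv.
have cB : compact [set x : E | forall v, I01 (x v)].
  exact: (@tychonoff K (fun=> R) (fun=> I01) (fun=> @segment_compact _ _ _)).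
have cS : closed [set x : E | \sum_v x v = 1].
  have cs : continuous (fun x : E => \sum_v x v) by exact: continuous_sum.
  by move/continuous_closedP: cs => /(_ [set r | r = 1]); apply; exact: closed_eq.
have cF : closed (\bigcap_(Q in [set Q : {set K} | Q \notin F])
    [set x : E | min_on Q x <= 0]).
  apply: closed_bigI => Q _.
  have /continuous_closedP cm := @continuous_min_on R K Q.
  by apply: (cm [set r | r <= 0]); exact: closed_le.
apply: subclosed_compact (cB) _; last first.
  move=> x [x0 x1 sx] v; rewrite /= I01E x0.
  by apply: (@carried_le1 _ _ F).
rewrite (_ : [set x : E | _] = [set x : E | forall v, I01 (x v)] `&`
  [set x : E | \sum_v x v = 1] `&` (\bigcap_(Q in [set Q : {set K} | Q \notin F])
    [set x : E | min_on Q x <= 0])).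
  apply: closedI cF; apply: closedI cS.
  rewrite (_ : [set x | _] = \bigcap_v [set x : E | I01 (x v)]).
    apply: closed_bigI => v _; have /continuous_closedP cm := cp v.
    by apply: (cm I01); exact: itv_closed.
  by apply/seteqP; split => x h; [move=> v _; exact: h|move=> v; exact: (h v Logic.I)].
apply/seteqP; split => x [].
  move=> x0 x1 sx; split; [split=> // v; rewrite /= I01E x0|].
    by apply: (@carried_le1 _ _ F).
  move=> Q /= /negP QF; rewrite leNgt; apply/negP => m0; apply: QF.
  apply: faces_sub sx; apply/fintype.subsetP => v Qv.
  by rewrite inE gt_eqF // (lt_le_trans m0) // min_on_le.
move=> [x01 x1] sx; have x0 v : 0 <= x v.
  by have := x01 v; rewrite /= I01E => /andP[].
split=> //; apply/negPn/negP => /sx /=; apply/negP; rewrite -ltNge.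
case: (min_on_cases (vsupport x) x) => [->|[v]]; first exact: ltr01.
by rewrite inE => xv ->; rewrite lt0r xv x0.
Qed.

(** * Extending the contraction over the critical simplices *)

Section Extension.
Variables (c : E * R -> E) (a : E).
Hypothesis cA : contracts A c a.

(** Homotopies have all of [R] as time domain; clamping keeps the deformation inside the complex at
    every time. *)
Definition clamp (s : R) : R := Num.min 1 (Num.max 0 s).
(** The largest multiple of the barycenter of the simplex that can be subtracted from [x] before a
    coordinate on the face becomes negative. *)
Definition weight j (x : E) : R := (d j).+1%:R * M j x.
(** With the speed 1/2 the cut is at most 1/2 up to time 1, which bounds the rescaling factor; the
    boundary is reached at time [2 * weight]. *)
Definition cut j (xs : E * R) : R := Num.min (weight j xs.1) (xs.2 / 2).

(* Subtracting a multiple of the barycenter of the open simplex and rescaling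
   moves a point radially towards the boundary; [cut] stops it there. *)
Definition expand (xs : E * R) : E := fun v =>
  (xs.1 v - \sum_j cut j xs * ((v \in face j)%:R / (d j).+1%:R)) *
  (Num.max 2^-1 (1 - \sum_j cut j xs))^-1.

(** The point moves radially until it reaches the boundary at time [2 * weight], and only then does
    [c] start. On the subcomplex all weights vanish and [c] runs from the beginning. *)
Definition extension (xs : E * R) : E :=
  c (expand (xs.1, clamp xs.2),
     Num.max 0 (clamp xs.2 - 2 * \sum_j weight j xs.1)).

Lemma clamp_itv s : 0 <= clamp s <= 1.
Proof. by rewrite /clamp le_min ge_min ler01 lexx le_max lexx. Qed.

Lemma clamp_id s : 0 <= s <= 1 -> clamp s = s.
Proof. by case/andP => s0 s1; rewrite /clamp (max_idPr s0) (min_idPr s1). Qed.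

Lemma continuous_extension : continuous extension.
Proof.
have [cc _ _ _ _] := cA.
have cw j : continuous (weight j).
  by apply: continuous_mulR; [exact: continuous_cstR|exact: continuous_min_on].
have ccut j : continuous (cut j).
  apply: continuous_minR.
    exact: (continuous_compose (@continuous_fst E R) (cw j)).
  by apply: continuous_mulR; [exact: continuous_snd|exact: continuous_cstR].
have cexpand : continuous expand.
  apply: continuous_ptws => v; apply: continuous_mulR.
    apply: continuous_subR.
      exact: (@continuous_coord R (E * R)%type K fst v (@continuous_fst _ _)).
    by apply: continuous_sum => j; apply: continuous_mulR => //;
      exact: continuous_cstR.
  (* The maximum with 1/2 keeps the denominator positive on all of [R^V]; on the polyhedron, at
     times in [0, 1], it equals 1 minus the sum of the cuts. *)
  apply: continuous_invR => [xs|].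
    by rewrite gt_eqF // lt_max invr_gt0 ltr0n.
  apply: continuous_maxR; first exact: continuous_cstR.
  apply: continuous_subR; first exact: continuous_cstR.
  exact: continuous_sum.
have cclamp : continuous (fun xs : E * R => clamp xs.2).
  apply: continuous_minR; first exact: continuous_cstR.
  by apply: continuous_maxR; [exact: continuous_cstR|exact: continuous_snd].
apply: (@continuous_compose _ _ _ (fun xs : E * R =>
  (expand (xs.1, clamp xs.2), Num.max 0 (clamp xs.2 - 2 * \sum_j weight j xs.1)))
  c) => //.
apply: continuous_pair.
  apply: (@continuous_compose _ _ _ (fun xs : E * R => (xs.1, clamp xs.2))) => //.
  by apply: continuous_pair => //; exact: continuous_fst.
apply: continuous_maxR; first exact: continuous_cstR.
apply: continuous_subR => //; apply: continuous_mulR.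
  exact: continuous_cstR.
apply: continuous_sum => j.
exact: (continuous_compose (@continuous_fst E R) (cw j)).
Qed.

Lemma expand_nonface (x : E) s : carried F x -> carried A x -> 0 <= s ->
  expand (x, s) = x.
Proof.
move=> Fx /(carried_nonface Fx) m0 s0; have c0 j : cut j (x, s) = 0.
  by rewrite /cut /weight /= m0 mulr0; apply/min_idPl; rewrite divr_ge0.
apply/funext => v; rewrite /expand /=.
rewrite big1 => [|j _]; last by rewrite c0 mul0r.
rewrite big1 => [|j _]; last by rewrite c0.
by rewrite !subr0 (max_idPr _) ?invr1 ?mulr1 // invf_le1 ?ler1n ?ltr0n.
Qed.

Lemma extension_nonface (x : E) s : carried F x -> carried A x ->
  extension (x, s) = c (x, clamp s).
Proof.
move=> Fx Ax; have /andP[s0 s1] := clamp_itv s.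
rewrite /extension expand_nonface //=.
move/(carried_nonface Fx) : Ax => m0.
rewrite big1 => [|j _]; last by rewrite /weight m0 mulr0.
by rewrite mulr0 subr0 (max_idPr s0).
Qed.

Section OpenFace.
Variables (j : J) (x : E) (s : R).
Hypotheses (Fx : carried F x) (mj : 0 < M j x) (s01 : 0 <= s <= 1).

Let q := Num.min (weight j x) (s / 2).

Lemma weight_other i : i != j -> weight i x = 0.
Proof. by move=> ij; rewrite /weight (min_unique Fx mj ij) mulr0. Qed.

Lemma sum_weight : \sum_i weight i x = weight j x.
Proof. by rewrite (bigD1 j) //= big1 ?addr0 // => i; exact: weight_other. Qed.

Lemma cut_other i : i != j -> cut i (x, s) = 0.
Proof.
move=> ij; rewrite /cut /= weight_other //.
by apply/min_idPl; rewrite divr_ge0 //; case/andP: s01.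
Qed.

Lemma cut_le_half : q <= 2^-1.
Proof.
by rewrite ge_min; apply/orP; right; rewrite ler_piMl ?invr_ge0 //;
  case/andP: s01.
Qed.

Lemma expand_open v :
  expand (x, s) v = (x v - q * ((v \in face j)%:R / (d j).+1%:R)) / (1 - q).
Proof.
rewrite /expand /= (bigD1 j) //= big1 ?addr0 => [|i ij]; last first.
  by rewrite cut_other // mul0r.
rewrite (bigD1 j) //= big1 ?addr0 => [|i]; last exact: cut_other.
rewrite -[cut j _]/q (max_idPr _) //.
by have := cut_le_half; lra.
Qed.

Lemma one_minus_cut_gt0 : 0 < 1 - q.
Proof. by have := cut_le_half; lra. Qed.

Lemma vsupport_expand : vsupport (expand (x, s)) \subset face j.
Proof.
apply/fintype.subsetP => v; rewrite inE; apply: contra_neqT => vf.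
have xv : x v = 0.
  by apply/eqP; move: vf; rewrite -(min_gt0P Fx mj) inE negbK.
by rewrite expand_open xv (negbTE vf) mul0r mulr0 subr0 mul0r.
Qed.

(** A cut of at most the weight keeps the coordinates nonnegative; the total mass drops to [1 - q]
    and the division restores it to 1. *)
Lemma expand_carried : carried F (expand (x, s)).
Proof.
have [x0 x1 _] := Fx; have q1 := one_minus_cut_gt0; split.
- move=> v; rewrite expand_open; apply: divr_ge0; last exact: ltW.
  rewrite subr_ge0.
  case: (boolP (v \in face j)) => vf; last by rewrite mul0r mulr0.
  apply: le_trans (min_on_le x vf).
  by rewrite mul1r ler_pdivrMr ?ltr0n // mulrC /q ge_min lexx.
- under eq_bigr do rewrite expand_open.
  rewrite -mulr_suml sumrB x1 -mulr_sumr -mulr_suml.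
  have -> : \sum_v (v \in face j)%:R = (d j).+1%:R :> R.
    rewrite -natr_sum -[in RHS](card_ord (d j).+1) -cardsT.
    rewrite -(card_imset _ (e_inj j)) -sum1_card [in RHS]big_mkcond /=.
    by congr (_%:R); apply: eq_bigr => v _; case: ifP.
  by rewrite divff ?pnatr_eq0 // mulr1 divff // gt_eqF.
- exact: faces_sub vsupport_expand (face_F j).
Qed.

(** By then the cut equals the weight, so the coordinate attaining the minimum vanishes and the
    support is a proper subset of the facet. *)
Lemma expand_boundary : 2 * weight j x < s -> carried A (expand (x, s)).
Proof.
move=> ws; have [y0 y1 sy] := expand_carried; split=> //.
rewrite inE sy /=; apply/forallP => i; apply/eqP => syi.
have qE : q = weight j x by apply/min_idPl; lra.
have fij : face j = face i.
  by apply: face_max; [exact: face_F|rewrite -syi; exact: vsupport_expand].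
have [v vf xv] := min_on_attained Fx (@face_neq0 K (d j) (e j)).
have : v \in vsupport (expand (x, s)) by rewrite syi -fij.
rewrite inE expand_open vf qE /weight xv.
by rewrite mul1r mulrAC divff ?pnatr_eq0 // mul1r subrr mul0r eqxx.
Qed.

(** Before the boundary is reached [c] stands at time 0 and is the identity; afterwards it acts on a
    point of the subcomplex, which it preserves. *)
Lemma extension_open_carried :
  carried F (c (expand (x, s), Num.max 0 (s - 2 * \sum_i weight i x))).
Proof.
have [_ c0 cA' _ _] := cA; rewrite sum_weight.
have [ws|ws] := leP s (2 * weight j x).
  rewrite (max_idPl _) ?subr_le0 // c0; exact: expand_carried.
rewrite (max_idPr _) ?subr_ge0 ?ltW //.
have sAF : A \subset F by apply/fintype.subsetP => Q; rewrite inE => /andP[].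
apply: (carried_sub sAF); apply: cA'; first exact: expand_boundary.
have w0 : 0 < weight j x by rewrite mulr_gt0 ?ltr0n.
by case/andP: s01 => s0 s1; apply/andP; split; lra.
Qed.

End OpenFace.

Lemma extension_nonface_carried x s : carried F x -> carried A x ->
  carried A (extension (x, s)).
Proof.
have [_ _ cA' _ _] := cA => Fx Ax.
by rewrite extension_nonface //; apply: cA' => //; exact: clamp_itv.
Qed.

Lemma nonface_faces (x : E) : carried A x -> carried F x.
Proof.
by apply: carried_sub; apply/fintype.subsetP => Q; rewrite inE => /andP[].
Qed.

Lemma extension_carried x s : carried F x -> carried F (extension (x, s)).
Proof.
move=> Fx; case: (nonface_or_open Fx) => [Ax|[j mj]].
  by apply: nonface_faces; exact: extension_nonface_carried.
by apply: (extension_open_carried Fx mj); exact: clamp_itv.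
Qed.

Lemma extension0 x : carried F x -> extension (x, 0) = x.
Proof.
have [_ c0 _ _ _] := cA => Fx.
have w0 j : 0 <= weight j x.
  by rewrite mulr_ge0 // min_on_ge0 //; case: Fx.
have z0 : clamp 0 = 0 by rewrite clamp_id // lexx ler01.
rewrite /extension /= z0 (max_idPl _); last first.
  by rewrite sub0r oppr_le0 mulr_ge0 // sumr_ge0.
rewrite c0; apply/funext => v; rewrite /expand /=.
have cut0 j : cut j (x, 0) = 0 by rewrite /cut /= mul0r; exact/min_idPr.
rewrite big1 => [|j _]; last by rewrite cut0 mul0r.
rewrite big1 => [|j _]; last by rewrite cut0.
by rewrite !subr0 (max_idPr _) ?invr1 ?mulr1 // invf_le1 ?ler1n ?ltr0n.
Qed.

Lemma extension1 x : carried A x -> extension (x, 1) = a.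
Proof.
have [_ _ _ c1 _] := cA => Ax.
rewrite extension_nonface //; last exact: nonface_faces.
by rewrite clamp_id ?c1 // ler01 lexx.
Qed.

Lemma deformP (xs : X * R) :
  extension (\val xs.1, xs.2) \in [set x : E | @barycentric R K x].
Proof.
apply/mem_set; apply: (@extension_carried (\val xs.1) xs.2).
exact: realization_carried.
Qed.

Definition deform (xs : X * R) : X := SigSub (deformP xs).

Lemma continuous_deform : continuous deform.
Proof.
apply: continuous_set_type.
apply: (@continuous_compose _ _ _ (fun xs : X * R => (\val xs.1, xs.2) : E * R)).
  apply: continuous_pair; last exact: continuous_snd.
  apply: (continuous_compose (@continuous_fst X R)); exact: continuous_val.
exact: continuous_extension.
Qed.

Lemma deform0 x : deform (x, 0) = x.
Proof. by apply: val_inj; apply: extension0; exact: realization_carried. Qed.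

(** The deformation preserves the subcomplex, and off it [collapse] is injective. Thus every stage
    induces a map of the wedge to itself. *)
Lemma collapse_deform x y s : collapse x = collapse y ->
  collapse (deform (x, s)) = collapse (deform (y, s)).
Proof.
case/collapse_eq => [-> //|[Ax Ay]]; rewrite !collapse_nonface //;
  by apply: extension_nonface_carried => //; exact: realization_carried.
Qed.

(** At time 1 the subcomplex has shrunk to the point [a], so the last stage factors through
    [collapse]; the factor is the homotopy inverse. *)
Lemma deform1 x y : collapse x = collapse y -> deform (x, 1) = deform (y, 1).
Proof.
case/collapse_eq => [-> //|[Ax Ay]]; apply: val_inj.
by rewrite /= !extension1.
Qed.

Lemma collapse_homotopy_equivalence : homotopy_equivalent R X Y.
Proof.
have qsurj : forall y : Y, exists x, collapse x = y.
  by apply: collapse_surj; exists a; case: cA.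
(* An arbitrary section of [collapse]. The maps built from it do not depend on the chosen preimages,
   so their continuity follows from the quotient property. *)
pose pre (y : Y) : X := projT1 (cid (qsurj y)).
have preK y : collapse (pre y) = y by rewrite /pre; case: cid.
pose g (y : Y) : X := deform (pre y, 1).
have gq x : g (collapse x) = deform (x, 1) by apply: deform1; rewrite preK.
have cdef (f : R -> R) : continuous f ->
    continuous (fun xs : X * R => deform (xs.1, f xs.2)).
  move=> cf.
  apply: (@continuous_compose _ _ _ (fun xs : X * R => (xs.1, f xs.2)) deform).
    apply: continuous_pair; first exact: continuous_fst.
    exact: (continuous_compose (@continuous_snd X R) cf).
  exact: continuous_deform.
(* Time is reversed: the deformation starts at the identity, while the required homotopies end
   there. *)
have crev : continuous (fun s : R => 1 - s).
  by apply: continuous_subR; [exact: continuous_cstR|move=> s; exact: cvg_id].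
exists collapse, g; split.
- exact: continuous_collapse.
- apply: (@continuous_quotient _ _ _ collapse) => //.
  + exact: realization_compact.
  + exact: wedge_spheres_hausdorff.
  + exact: continuous_collapse.
  + rewrite (_ : _ \o _ = fun x => deform (x, 1)); last exact/funext.
    apply: (@continuous_compose _ _ _ (fun x : X => (x, 1 : R)) deform).
      apply: continuous_pair; [by move=> x; exact: cvg_id|exact: cst_continuous].
    exact: continuous_deform.
- exists (fun xs => deform (xs.1, 1 - xs.2)); split.
  + by apply: continuous_subspaceT; exact: (cdef _ crev).
  + by move=> x /=; rewrite subr0 gq.
  + by move=> x /=; rewrite subrr deform0.
- exists (fun ys => collapse (deform (pre ys.1, 1 - ys.2))); split.
  + apply: (@homotopy_quotient _ _ _ _ collapse) => //.
    * exact: realization_compact.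
    * exact: wedge_spheres_hausdorff.
    * exact: continuous_collapse.
    * rewrite (_ : (fun _ => _) =
        fun xs : X * R => collapse (deform (xs.1, 1 - xs.2))).
        by apply: continuous_compose continuous_collapse; exact: (cdef _ crev).
      apply/funext => xs /=; apply: collapse_deform; exact: preK.
  + by move=> y /=; rewrite subr0.
  + by move=> y /=; rewrite subrr deform0 preK.
Qed.

End Extension.

End Quotient.

(** * Matchings of caterpillars *)

Section CriticalFaces.
Import mathcomp.boot.fintype mathcomp.boot.finset.

Lemma enum_face (V : finType) (P : {set V}) d (cP : #|P| = d.+1) :
  [set enum_val (cast_ord (esym cP) i) | i in [set: 'I_d.+1]]%SET = P.
Proof.
apply/setP => v; apply/imsetP/idP => [[i _ ->]|Pv]; first exact: enum_valP.
exists (cast_ord cP (enum_rank_in Pv v)) => //.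
by rewrite cast_ordK enum_rankK_in.
Qed.

Lemma critical_homotopy_equivalence (R : realType) (K : scomplex) (J : finType)
    (d : J -> nat) (s : J -> {set K}) :
  injective s -> (forall j, #|s j| = (d j).+1) -> (forall j, s j \in faces K) ->
  (forall j Q, Q \in faces K -> s j \subset Q -> Q = s j) ->
  collapsible [set Q in faces K | [forall j, Q != s j]] -> J ->
  homotopy_equivalent R (realization R K)
    (@wedge J (fun j => sphere R (d j)) (fun j => sphere_base R (d j))).
Proof.
move=> s_inj cs sF smax coll j0.
have [c [a ca]] := collapsible_contracts R coll.
pose e j (i : 'I_(d j).+1) : K := enum_val (cast_ord (esym (cs j)) i).
have eE j : e j @: [set: 'I_(d j).+1] = s j by exact: enum_face.
apply: (@collapse_homotopy_equivalence R K J d e _ _ _ _ j0 c a).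
- by move=> j i i' /enum_val_inj/cast_ord_inj.
- by move=> j; rewrite eE.
- by move=> j Q; rewrite eE; exact: smax.
- by move=> i j; rewrite !eE => /s_inj.
- rewrite (_ : [set Q in _ | _] = [set Q in faces K | [forall j, Q != s j]]) //.
  by apply/setP => Q; rewrite !inE; congr andb; apply: eq_forallb => j; rewrite eE.
Qed.

End CriticalFaces.

Section Caterpillar.
Import mathcomp.boot.fintype mathcomp.boot.finset.
Local Open Scope nat_scope.
Variables m n : nat.
(** With [m.+1] legs at each central vertex, [m] counts those other than the first, that is, the
    colours of the single tiles. *)
Local Notation G := (perfect_caterpillar m.+1 n).
Implicit Types (P Q : {set edge G}) (S : {set {set edge G}}) (x y : edge G).

Definition covered Q (v : G) := [exists x in Q, v \in val x].

(** For [i = n] these are the critical matchings; for smaller [i] they are the partial ones whose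
    stars are pushed away. *)
Definition prefix i Q := [&& matching Q,
  [forall a, ~~ covered Q (inr (a, ord0))] &
  [forall a : 'I_n, covered Q (inl a) == (a < i)]].

(** A common description of the edges, non-first legs and bonds alike, that lengthen a prefix from
    [i] to [i']. *)
Definition tile i i' x :=
  [forall a : 'I_n, (inl a \in val x) == (i <= a < i')] &&
  [forall a, inr (a, ord0) \notin val x].

Lemma leg_edge i b : [set inl i; inr (i, b)] \in edges G.
Proof.
by apply/imsetP; exists (inl i, inr (i, b)) => //; rewrite inE /= eqxx.
Qed.

Definition leg i b : edge G := Sub [set inl i; inr (i, b)] (leg_edge i b).

Lemma bond_edge (i j : 'I_n) : i.+1 = j -> [set inl i; inl j] \in edges G.
Proof.
by move=> ij; apply/imsetP; exists (inl i, inl j) => //; rewrite inE /= ij eqxx.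
Qed.

Definition bond (i j : 'I_n) (ij : i.+1 = j) : edge G :=
  Sub [set inl i; inl j] (bond_edge ij).

Lemma edge_cases x :
  (exists i b, x = leg i b) \/ (exists (i j : 'I_n) (ij : i.+1 = j), x = bond ij).
Proof.
case: (imsetP (valP x)) => -[u v]; rewrite inE /= => uv xE.
case: u v uv xE => [i|[i b]] [j|[j c]] //=
  => [/orP[/eqP ij|/eqP ij] xE|/eqP -> xE|/eqP -> xE].
- by right; exists i, j, ij; apply: val_inj.
- by right; exists j, i, ij; apply: val_inj; rewrite /= xE setUC.
- by left; exists j, c; apply: val_inj.
- by left; exists j, b; apply: val_inj; rewrite /= xE setUC.
Qed.

Lemma leaf_edge x i b : inr (i, b) \in val x -> x = leg i b.
Proof.
case: (edge_cases x) => [[j [c ->]]|[j [k [jk ->]]]]; rewrite !inE //=.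
by case/eqP => -> ->.
Qed.

Lemma edge_center x : exists a, inl a \in val x.
Proof.
by case: (edge_cases x) => [[j [c ->]]|[j [k [jk ->]]]]; exists j;
  rewrite !inE eqxx.
Qed.

Lemma tile_leg (i : 'I_n) (b : 'I_m) : tile i i.+1 (leg i (lift ord0 b)).
Proof.
apply/andP; split; apply/forallP => a; rewrite !inE /=.
  rewrite -[inl a == inl i]/(a == i) -val_eqE /= orbF ltnS -eqn_leq.
  by apply/eqP; exact: eq_sym.
by apply/negP => /eqP[_].
Qed.

Lemma tile_bond (i j : 'I_n) (ij : i.+1 = j) : tile i j.+1 (bond ij).
Proof.
apply/andP; split; apply/forallP => a; rewrite !inE //=.
rewrite -[inl a == inl i]/(a == i) -[inl a == inl j]/(a == j) -!val_eqE /=.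
by apply/eqP; rewrite -ij; lia.
Qed.

Lemma matchingP Q : reflect
  (forall x y v, x \in Q -> y \in Q -> v \in val x -> v \in val y -> x = y)
  (matching Q).
Proof.
apply: (iffP forall_inP) => [mQ x y v Qx Qy vx vy|mQ x Qx].
  apply/eqP; apply/negPn/negP => xy.
  have /forall_inP/(_ y Qy) := mQ x Qx; rewrite xy /= => /pred0P/(_ v) /=.
  by rewrite vx vy.
apply/forall_inP => y Qy; apply/implyP => xy; apply/pred0P => v /=.
by apply/negP => /andP[vx vy]; rewrite (mQ x y v) ?eqxx in xy.
Qed.

Lemma coveredP Q v : reflect (exists2 x, x \in Q & v \in val x) (covered Q v).
Proof. exact: exists_inP. Qed.

Lemma prefix_matching i Q : prefix i Q -> matching Q.
Proof. by case/and3P. Qed.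

Lemma prefix_noleg0 i Q a : prefix i Q -> ~~ covered Q (inr (a, ord0)).
Proof. by case/and3P => _ /forallP. Qed.

Lemma prefix_center i Q (a : 'I_n) : prefix i Q -> covered Q (inl a) = (a < i).
Proof. by case/and3P => _ _ /forallP/(_ a)/eqP. Qed.

Lemma tile_center i i' x (a : 'I_n) : tile i i' x -> (inl a \in val x) = (i <= a < i').
Proof. by case/andP => /forallP/(_ a)/eqP. Qed.

Lemma tile_noleg0 i i' x a : tile i i' x -> inr (a, ord0) \notin val x.
Proof. by case/andP => _ /forallP. Qed.

(** A leaf lies on a single edge. Conflicts between edges can therefore be tested at central
    vertices alone. *)
Lemma shared_center x y v : v \in val x -> v \in val y ->
  exists2 a, inl a \in val x & inl a \in val y.
Proof.
case: v => [a|[a b]]; first by exists a.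
by move=> /leaf_edge -> /leaf_edge ->; exists a; rewrite !inE eqxx.
Qed.

Lemma matching_sub P Q : P \subset Q -> matching Q -> matching P.
Proof.
move=> sPQ mQ; have : P \in matchings G by apply: matchings_sub sPQ _; rewrite inE.
by rewrite inE.
Qed.

Lemma covered_add x Q v : covered (x |: Q) v = (v \in val x) || covered Q v.
Proof.
apply/coveredP/orP => [[y /setU1P[->|Qy] vy]|[vx|/coveredP[y Qy vy]]].
- by left.
- by right; apply/coveredP; exists y.
- by exists x; rewrite // setU11.
- by exists y; rewrite // setU1r.
Qed.

Lemma prefix_notin i i' x P : i < i' -> i < n -> prefix i P -> tile i i' x -> x \notin P.
Proof.
move=> ii' ltn pP tx; apply/negP => Px.
have : covered P (inl (Ordinal ltn)).
  by apply/coveredP; exists x => //; rewrite (tile_center _ tx) /= leqnn.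
by rewrite (prefix_center _ pP) /= ltnn.
Qed.

Lemma prefix_add i i' x P : i <= i' -> prefix i P -> tile i i' x -> prefix i' (x |: P).
Proof.
move=> ii' pP tx; have /matchingP mP := prefix_matching pP.
have dis y v : y \in P -> v \in val x -> v \in val y -> False.
  move=> Py vx vy; have [a ax ay] := shared_center vx vy.
  have : covered P (inl a) by apply/coveredP; exists y.
  rewrite (prefix_center _ pP) => ai; move: ax.
  by rewrite (tile_center _ tx) leqNgt ai.
apply/and3P; split.
- apply/matchingP => y z v /setU1P[->|Py] /setU1P[->|Pz] vy vz //.
  + by case: (dis z v).
  + by case: (dis y v).
  + exact: mP vz.
- apply/forallP => a; rewrite covered_add negb_or (tile_noleg0 _ tx).
  exact: prefix_noleg0 pP.
- apply/forallP => a; rewrite covered_add (tile_center _ tx) (prefix_center _ pP).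
  by apply/eqP; lia.
Qed.

Lemma prefix_remove i i' x Q : i <= i' -> prefix i' Q -> x \in Q -> tile i i' x ->
  prefix i (Q :\ x).
Proof.
move=> ii' pQ Qx tx; have mQ := prefix_matching pQ.
apply/and3P; split.
- by apply: matching_sub mQ; exact: subD1set.
- apply/forallP => a; apply: contra (prefix_noleg0 a pQ).
  case/coveredP => y /setD1P[_ Qy] ay; apply/coveredP; by exists y.
- apply/forallP => a; apply/eqP; apply/coveredP/idP => [[y /setD1P[yx Qy] ay]|ai].
    have : covered Q (inl a) by apply/coveredP; exists y.
    rewrite (prefix_center _ pQ) => ai'; rewrite ltnNge; apply/negP => ia.
    have ax : inl a \in val x by rewrite (tile_center _ tx) ia.
    by rewrite (matchingP _ mQ y x _ Qy Qx ay ax) eqxx in yx.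
  have : covered Q (inl a) by rewrite (prefix_center _ pQ) (leq_trans ai).
  case/coveredP => y Qy ay; exists y => //; rewrite in_setD1 Qy andbT.
  apply/eqP => yx; move: ay; rewrite yx (tile_center _ tx).
  by rewrite leqNgt ai.
Qed.

(** Every edge has a central endpoint, and these are all taken: critical matchings are facets. *)
Lemma prefix_maximal P Q : prefix n P -> matching Q -> P \subset Q -> Q = P.
Proof.
move=> pP /matchingP mQ sPQ; apply/eqP; rewrite eqEsubset sPQ andbT.
apply/subsetP => x Qx; have [a ax] := edge_center x.
have : covered P (inl a) by rewrite (prefix_center _ pP).
case/coveredP => y Py ay; rewrite (mQ x y (inl a)) //.
exact: (subsetP sPQ).
Qed.

Lemma prefix0 : prefix 0 set0.
Proof.
have c0 v : covered set0 v = false.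
  by apply/coveredP; case=> x; rewrite inE.
apply/and3P; split.
- by apply/matchingP => x y v; rewrite inE.
- by apply/forallP => a; rewrite c0.
- by apply/forallP => a; rewrite c0.
Qed.

Lemma prefix0_eq P : prefix 0 P -> P = set0.
Proof.
move=> pP; apply/setP => x; rewrite inE; apply/negP => Px.
have [a ax] := edge_center x.
have : covered P (inl a) by apply/coveredP; exists x.
by rewrite (prefix_center _ pP).
Qed.

(* The vertex [i] can only be matched to its leg 0, all other matches of [i]
   giving a longer prefix inside [Q]: the link of [P] is a cone. *)
Lemma add_leg0_matching (i : 'I_n) P Q : prefix i P -> P \subset Q -> matching Q ->
  (forall i' P', i < i' -> prefix i' P' -> ~~ (P' \subset Q)) ->
  matching (leg i ord0 |: Q).
Proof.
move=> pP sPQ /matchingP mQ longer.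
suff dis x : x \in Q -> inl i \in val x -> x = leg i ord0.
  have dis' x v : x \in Q -> v \in val (leg i ord0) -> v \in val x -> x = leg i ord0.
    move=> Qx /shared_center h /h[a]; rewrite !inE orbF => /eqP[->].
    exact: dis.
  apply/matchingP => x y v /setU1P[->|Qx] /setU1P[->|Qy] vx vy //.
  + by rewrite (dis' y v).
  + by rewrite (dis' x v).
  + exact: mQ vy.
move=> Qx ix; have extend j : i < j -> tile i j x -> False.
  move=> ij tx; have := longer j _ ij (prefix_add (ltnW ij) pP tx).
  by rewrite subUset sub1set Qx sPQ.
case: (edge_cases x) => [[j [b xE]]|[j [k [jk xE]]]]; move: ix; rewrite xE !inE /=.
  rewrite orbF => /eqP[ij]; subst j; case: (unliftP ord0 b) xE => [c ->|-> //] xE.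
  by case: (extend i.+1) => //; rewrite xE; exact: tile_leg.
case/orP => /eqP[ij].
  subst j; case: (extend k.+1); first by rewrite -jk.
  by rewrite xE; exact: tile_bond.
subst k; have : covered P (inl j) by rewrite (prefix_center _ pP) -jk.
case/coveredP => y Py jy; have xy : x = y.
  apply: (mQ x y (inl j)) => //; first exact: (subsetP sPQ).
  by rewrite xE !inE eqxx.
have : covered P (inl i).
  by apply/coveredP; exists y => //; rewrite -xy xE !inE eqxx orbT.
by rewrite (prefix_center _ pP) ltnn.
Qed.

Lemma prefix_cap i P : n <= i -> prefix i P -> prefix n P.
Proof.
move=> ni pP; apply/and3P; split; first exact: prefix_matching pP.
  by apply/forallP => a; exact: prefix_noleg0 pP.
apply/forallP => a; rewrite (prefix_center _ pP) ltn_ord.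
by rewrite (leq_trans (ltn_ord a) ni).
Qed.

Lemma prefix_neq0 i P : 0 < n -> 0 < i -> prefix i P -> P != set0.
Proof.
move=> n0 i0 pP; apply/set0Pn.
have : covered P (inl (Ordinal n0)) by rewrite (prefix_center _ pP).
by case/coveredP => x; exists x.
Qed.

(** * Collapsing the non-critical matchings *)

Definition avoiding S := [set Q in matchings G | [forall P in S, ~~ (P \subset Q)]].

Lemma avoiding_down S : down_closed (avoiding S).
Proof.
move=> P Q sPQ; rewrite !inE => /andP[mQ /forall_inP aQ].
rewrite (matching_sub sPQ mQ) /=; apply/forall_inP => T ST.
by apply: contra (aQ T ST) => sTP; exact: fintype.subset_trans sPQ.
Qed.

Lemma avoiding_add S P :
  avoiding (P |: S) = [set Q in avoiding S | ~~ (P \subset Q)].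
Proof.
apply/setP => Q; rewrite !inE -andbA; congr andb.
apply/forall_inP/andP => [h|[/forall_inP h hP] T /setU1P[->|] //]; last exact: h.
split; last by apply: h; exact: setU11.
by apply/forall_inP => T ST; apply: h; exact: setU1r.
Qed.

Lemma avoiding_star S (i : 'I_n) P :
  (forall T, T \in S -> exists j, prefix j T) -> prefix i P ->
  (forall i' P', i < i' -> prefix i' P' -> P' \in S) ->
  forall Q, Q \in avoiding S -> P \subset Q -> leg i ord0 |: Q \in avoiding S.
Proof.
move=> Sp pP up Q; rewrite !inE => /andP[mQ /forall_inP aQ] sPQ.
rewrite (add_leg0_matching pP sPQ mQ) /= => [|i' P' ii' pP']; last first.
  by apply: aQ; exact: up pP'.
apply/forall_inP => T ST; apply: contra (aQ T ST) => /subsetP sT.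
apply/subsetP => x Tx; case/setU1P: (sT x Tx) => // xE.
have [j pT] := Sp T ST; case/negP: (prefix_noleg0 i pT).
by apply/coveredP; exists x => //; rewrite xE !inE eqxx.
Qed.

(** Induction on the number of sets outside [S]. Each step removes the star of a longest nonempty
    prefix outside [S]; once none is left, what remains is a cone whose apex is the first leg of the
    first vertex. *)
Lemma avoiding_collapsible S : 0 < n -> set0 \notin S ->
  (forall T, T \in S -> exists j, prefix j T) ->
  (forall P, prefix n P -> P \in S) ->
  (forall i i' P P', prefix i P -> prefix i' P' -> P \in S -> i < i' -> P' \in S) ->
  collapsible (avoiding S).
Proof.
move=> n0; have [k] := ubnP #|~: S|; elim: k S => // k IH S cS S0 Sp Sn Sup.
pose out i := (i < n) && [exists P, [&& prefix i P, P != set0 & P \notin S]].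
have longer i : (forall j, out j -> j <= i) ->
    forall i' P', i < i' -> prefix i' P' -> P' \in S.
  move=> imax i' P' ii' pP'; have [ni|i'n] := leqP n i'.
    by apply: Sn; exact: prefix_cap pP'.
  apply/negPn/negP => P'S; have := imax i'; rewrite /out i'n /= leqNgt ii'.
  move=> h; have // : false; apply: h; apply/existsP; exists P'.
  by rewrite pP' P'S (prefix_neq0 n0 _ pP') // (leq_ltn_trans _ ii').
case: (boolP [exists i : 'I_n, out i]) => [/existsP[i0 oi0]|].
  have exo : exists i, out i by exists i0.
  have obd i : out i -> i <= n by case/andP => /ltnW.
  case: (ex_maxnP exo obd) => i /andP[ltn /existsP[P /and3P[pP P0 PS]]] imax.
  have up := longer i imax.
  apply: (@CollapsibleStar _ _ P (leg (Ordinal ltn) ord0)) => //.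
  - exact: avoiding_down.
  - apply/negP => Pp; case/negP: (prefix_noleg0 (Ordinal ltn) pP).
    by apply/coveredP; exists (leg (Ordinal ltn) ord0) => //; rewrite !inE eqxx.
  - exact: (@avoiding_star S (Ordinal ltn) P).
  rewrite -avoiding_add; apply: IH.
  - rewrite setCU setIC -setDE; rewrite ltnS in cS.
    apply: leq_trans (_ : _ <= #|~: S|) cS; apply: proper_card.
    by apply: properD1; rewrite inE.
  - by rewrite in_setU1 negb_or eq_sym P0.
  - by move=> T /setU1P[->|]; [exists i|exact: Sp].
  - by move=> T pT; rewrite in_setU1 Sn ?orbT.
  (* If the shorter prefix is the new member [P], then [j] is at least [i], and all prefixes longer
     than [i] already lie in [S] by maximality. *)
  - move=> j j' T T' pT pT' /setU1P[TP|TS] jj'; rewrite in_setU1; apply/orP; right.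
      apply: (up _ _ _ pT'); apply: leq_ltn_trans jj'; subst T.
      rewrite leqNgt; apply/negP => ji.
      have := prefix_center (Ordinal (ltn_trans ji ltn)) pP.
      by rewrite (prefix_center _ pT) /= ltnn ji.
    exact: Sup pT pT' TS jj'.
move/existsPn => noout.
have up : forall i' P', (Ordinal n0) < i' -> prefix i' P' -> P' \in S.
  apply: longer => j oj; have /andP[jn _] := oj.
  by have := noout (Ordinal jn); rewrite /= oj.
apply: (@CollapsibleCone _ _ (leg (Ordinal n0) ord0)).
  rewrite !inE (prefix_matching prefix0) /=; apply/forall_inP => T ST.
  by rewrite subset0; apply/eqP => T0; rewrite -T0 ST in S0.
move=> Q QS; apply: (@avoiding_star S (Ordinal n0) set0) => //.
- exact: prefix0.
- exact: sub0set.
Qed.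

(** * Counting the critical matchings by size *)

Definition prefixes i s := [set P | prefix i P && (#|P| == s)].

Definition add_leg (i : 'I_n) (u : 'I_m * {set edge G}) := leg i (lift ord0 u.1) |: u.2.

Lemma leg_inj i : injective (leg i).
Proof.
move=> b c /(congr1 val)/setP/(_ (inr (i, b))).
by rewrite !inE !eqxx orbT => /esym /= /eqP[].
Qed.

Lemma card_add_leg (i : 'I_n) s :
  #|add_leg i @: setX [set: 'I_m] (prefixes i s)| = m * #|prefixes i s|.
Proof.
rewrite card_in_imset ?cardsX ?cardsT ?card_ord // => -[b P] [c Q].
rewrite !inE /= /add_leg /= => /andP[pP _] /andP[pQ _] E0.
have nP b' : leg i (lift ord0 b') \notin P.
  by apply: prefix_notin pP (tile_leg i b').
have nQ b' : leg i (lift ord0 b') \notin Q.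
  by apply: prefix_notin pQ (tile_leg i b').
have bc : b = c.
  have := setU11 (leg i (lift ord0 b)) P; rewrite E0 => /setU1P[|/(negP (nQ b)) //].
  by move/leg_inj/lift_inj.
by rewrite bc -(setU1K (nP b)) E0 bc setU1K.
Qed.

Lemma card_add_bond (j i : 'I_n) (ji : j.+1 = i) s :
  #|(fun P => bond ji |: P) @: prefixes j s| = #|prefixes j s|.
Proof.
rewrite card_in_imset // => P Q; rewrite !inE => /andP[pP _] /andP[pQ _] E0.
have nb T : prefix j T -> bond ji \notin T.
  by move=> pT; apply: prefix_notin pT (tile_bond ji) => //; lia.
by rewrite -(setU1K (nb P pP)) E0 setU1K // nb.
Qed.

(** The vertex [i] is covered, but not by its first leg, and not by the bond to its right, which
    would cover a vertex beyond the prefix. *)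
Lemma prefix_last (i : 'I_n) Q : prefix i.+1 Q -> exists2 x, x \in Q &
  (exists b, x = leg i (lift ord0 b)) \/ (exists (j : 'I_n) (ji : j.+1 = i), x = bond ji).
Proof.
move=> pQ; have : covered Q (inl i) by rewrite (prefix_center _ pQ) ltnSn.
case/coveredP => x Qx ix; exists x => //.
case: (edge_cases x) => [[j [b xE]]|[j [k [jk xE]]]]; move: ix; rewrite xE !inE /=.
  rewrite orbF => /eqP[ij]; subst j; left.
  case: (unliftP ord0 b) xE => [c ->|-> xE]; first by exists c.
  case/negP: (prefix_noleg0 i pQ); apply/coveredP; exists x => //.
  by rewrite xE !inE eqxx.
case/orP => /eqP[ij]; subst.
  have : covered Q (inl k) by apply/coveredP; exists (bond jk); rewrite ?inE ?eqxx ?orbT.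
  by rewrite (prefix_center _ pQ) -jk ltnn.
by right; exists j, jk.
Qed.

Lemma prefixes_add i i' x P s : i < i' -> i < n -> tile i i' x ->
  P \in prefixes i s -> x |: P \in prefixes i' s.+1.
Proof.
move=> ii' ltn tx; rewrite !inE => /andP[pP /eqP cP].
by rewrite (prefix_add (ltnW ii') pP tx) cardsU1 (prefix_notin ii' ltn pP tx) cP /=.
Qed.

Lemma prefixes_remove i i' x Q s : i <= i' -> tile i i' x -> x \in Q ->
  Q \in prefixes i' s.+1 -> Q :\ x \in prefixes i s.
Proof.
move=> ii' tx Qx; rewrite !inE => /andP[pQ /eqP cQ].
rewrite (prefix_remove ii' pQ Qx tx) /=.
by have := cardsD1 x Q; rewrite Qx cQ add1n => -[<-].
Qed.

Lemma card_prefixes1 (n0 : 0 < n) s : #|prefixes 1 s.+1| = m * #|prefixes 0 s|.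
Proof.
rewrite -(card_add_leg (Ordinal n0)); congr #|pred_of_set _|.
apply/setP => Q; apply/idP/imsetP => [Qp|[[b P]]].
  have pQ : prefix 1 Q by case/setIdP: Qp.
  have [x Qx [[b xE]|[j [ji _]]]] := @prefix_last (Ordinal n0) Q pQ; last by [].
  have tx := tile_leg (Ordinal n0) b; rewrite -xE in tx.
  exists (b, Q :\ x); last by rewrite /add_leg /= -xE setD1K.
  by rewrite inE in_setT; exact: prefixes_remove tx Qx Qp.
rewrite inE in_setT /= => Pp ->.
exact: (prefixes_add _ _ (tile_leg (Ordinal n0) b)).
Qed.

(** The last tile is a leg in one of [m] colours or the domino on [j] and [i]; removing it leaves a
    prefix with one edge fewer. *)
Lemma card_prefixes_step (j i : 'I_n) (ji : j.+1 = i) s :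
  #|prefixes i.+1 s.+1| = m * #|prefixes i s| + #|prefixes j s|.
Proof.
rewrite -(card_add_leg i) -(card_add_bond ji) -cardsUI.
rewrite [X in _ = _ + X]eq_card0 ?addn0 => [|Q].
  congr #|pred_of_set _|; apply/setP => Q; apply/idP/setUP => [Qp|].
    have pQ : prefix i.+1 Q by case/setIdP: Qp.
    have [x Qx [[b xE]|[j' [ji' xE]]]] := prefix_last pQ.
      have tx := tile_leg i b; rewrite -xE in tx.
      left; apply/imsetP; exists (b, Q :\ x); last by rewrite /add_leg /= -xE setD1K.
      by rewrite inE in_setT; exact: prefixes_remove tx Qx Qp.
    have jj : j' = j by apply: val_inj; have := ji'; rewrite -ji => -[].
    subst j'; rewrite (eq_irrelevance ji' ji) in xE.
    have tx := tile_bond ji; rewrite -xE in tx.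
    right; apply/imsetP; exists (Q :\ x); last by rewrite -xE setD1K.
    by apply: prefixes_remove tx Qx Qp; lia.
  case=> /imsetP[]; last first.
    move=> P Pp ->; apply: (prefixes_add _ _ (tile_bond ji)) => //; lia.
  case=> b P; rewrite inE in_setT /= => Pp ->.
  exact: (prefixes_add _ _ (tile_leg i b)).
apply/negP => /setIP[/imsetP[[b P] _ ->] /imsetP[P' Pp' E0]].
have := setU11 (leg i (lift ord0 b)) P; rewrite -/(add_leg i (b, P)) E0.
case/setU1P => [/(congr1 val)/setP/(_ (inr (i, lift ord0 b)))|Pl].
  by rewrite !inE eqxx orbT.
have : covered P' (inl i).
  by apply/coveredP; exists (leg i (lift ord0 b)) => //; rewrite !inE eqxx.
have pP' : prefix j P' by case/setIdP: Pp'.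
by rewrite (prefix_center _ pP') -ji; lia.
Qed.

Lemma card_prefixes0 s : #|prefixes 0 s| = (s == 0).
Proof.
case: s => [|s].
  rewrite (_ : prefixes 0 0 = [set set0]) ?cards1 //; apply/setP => P.
  rewrite !inE cards_eq0; apply/andP/eqP => [[_ /eqP //]|->].
  by rewrite prefix0 eqxx.
apply/eqP; rewrite cards_eq0; apply/eqP/setP => P; rewrite !inE.
by apply/negP => /andP[/prefix0_eq ->]; rewrite cards0.
Qed.

Lemma card_prefixesS0 i : 0 < n -> #|prefixes i.+1 0| = 0.
Proof.
move=> n0; apply/eqP; rewrite cards_eq0; apply/eqP/setP => P; rewrite !inE.
by apply/negP => /andP[/(prefix_neq0 n0 (ltn0Sn i)) /negP P0]; rewrite cards_eq0.
Qed.

(** A tiling of [i] vertices by [s] tiles has [i - s] dominoes and [2 * s - i] coloured singles; the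
    recurrence becomes Pascal's rule. The test [s <= i] guards the truncated subtraction in the
    binomial. *)
Lemma card_prefixes i s : i <= n ->
  #|prefixes i s| = if s <= i then 'C(s, i - s) * m ^ (2 * s - i) else 0.
Proof.
have [n0|n0] := posnP n.
  move=> lin; have -> : i = 0 by lia.
  by rewrite card_prefixes0; case: s.
elim/ltn_ind: i s => -[_|[_|i IH]] [|s] ltin; rewrite ?card_prefixes0 //.
- by rewrite card_prefixesS0.
- rewrite card_prefixes1 // card_prefixes0; case: s => [|s]; last by rewrite muln0.
  by rewrite mul1n !muln1 expn1.
- by rewrite card_prefixesS0.
have ji : (Ordinal (ltnW ltin) : 'I_n).+1 = (Ordinal ltin : 'I_n) by [].
rewrite (card_prefixes_step ji) /= !IH //; try lia.
rewrite ltnS; have [si|si] := leqP s i; last first.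
  have [<-|ne] := eqVneq s i.+1; last by rewrite !ifN //; lia.
  by rewrite !leqnn !subnn !bin0 !mul1n addn0 -expnS; congr (_ ^ _); lia.
rewrite !ifT; try lia.
have -> : i.+2 - s.+1 = (i - s).+1 by lia.
have -> : i.+1 - s = (i - s).+1 by lia.
rewrite binS mulnDl; congr (_ + _); last by congr (_ * _ ^ _); lia.
(* If [2 * s] is below [i.+1] the exponent is truncated, but then the binomial coefficient
   vanishes. *)
have [lt2|ge2] := ltnP (2 * s) i.+1; last first.
  by rewrite mulnCA -expnS; congr (_ * _ ^ _); lia.
by rewrite bin_small ?muln0 ?mul0n //; lia.
Qed.

(** Read off from the count, which must be nonzero at the size of [P]. *)
Lemma prefix_size P : prefix n P -> #|P| <= n <= 2 * #|P|.
Proof.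
move=> pP; have : 0 < #|prefixes n #|P| |.
  by apply/card_gt0P; exists P; rewrite inE pP eqxx.
rewrite card_prefixes //; case: ifP => // Pn.
by rewrite muln_gt0 bin_gt0; lia.
Qed.

End Caterpillar.

(** * Assembling the wedge of spheres *)

Section Conclusion.
Import mathcomp.boot.fintype mathcomp.boot.finset.
Local Open Scope nat_scope.
Variables (R : realType) (m n : nat).
Hypothesis n0 : 0 < n.
Local Notation G := (perfect_caterpillar m.+1 n).

(** Numbering the critical matchings of each dimension [d t] by ['I_(c t)] identifies the index set
    of the wedge with the set of all critical matchings. *)
Lemma wedge_of_prefixes (k : nat) (c d : nat -> nat) :
  (forall t, t <= k -> c t = #|prefixes m n n (d t).+1|) ->
  (forall t t', t <= k -> t' <= k -> d t = d t' -> t = t') ->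
  (forall P : {set edge G}, prefix n P -> exists2 t, t <= k & #|P| = (d t).+1) ->
  (exists2 t, t <= k & 0 < c t) ->
  homotopy_equivalent R (realization R (matching_complex G))
    (wedge_spheres R k c d).
Proof.
move=> cE d_inj szP [t0 t0k ct0].
pose J : finType := {t : 'I_k.+1 & 'I_(c t)}.
pose mk (t : 'I_k.+1) (a : 'I_(c t)) : J := existT _ t a.
pose s (j : J) : {set edge G} :=
  nth set0 (enum (prefixes m n n (d (tag j)).+1)) (tagged j).
have tagk (j : J) : tag j <= k by rewrite -ltnS ltn_ord.
have szj (j : J) : tagged j < size (enum (prefixes m n n (d (tag j)).+1)).
  by rewrite -cardE -cE // ltn_ord.
have sP j : s j \in prefixes m n n (d (tag j)).+1 by rewrite -mem_enum mem_nth.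
have sp j : prefix n (s j) by have /setIdP[] := sP j.
have sc j : #|s j| = (d (tag j)).+1 by have /setIdP[_ /eqP] := sP j.
have s_surj P : prefix n P -> exists j, s j = P.
  move=> pP; have [t tk cP] := szP P pP.
  have Pt : P \in enum (prefixes m n n (d t).+1) by rewrite mem_enum inE pP cP eqxx.
  have ic : index P (enum (prefixes m n n (d t).+1)) < c (inord t : 'I_k.+1).
    by rewrite inordK // cE // cardE index_mem.
  exists (mk (inord t) (Ordinal ic)).
  by rewrite /s /= inordK // nth_index.
apply: (@critical_homotopy_equivalence R (matching_complex G) J
  (fun j => d (tag j)) s).
- move=> [t a] [t' a'] E0.
  have tt : t = t'.
    apply/val_inj/d_inj; [exact: (tagk (mk t a))|exact: (tagk (mk t' a'))|].
    by apply: succn_inj; rewrite -(sc (mk t a)) -(sc (mk t' a')) E0.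
  subst t'; congr existT; apply: val_inj; apply/eqP.
  rewrite -(nth_uniq set0 (szj (mk t a)) (szj (mk t a'))) ?enum_uniq //.
  exact/eqP.
- exact: sc.
- by move=> j; rewrite inE (prefix_matching (sp j)).
- move=> j Q; rewrite inE => mQ; exact: prefix_maximal.
- rewrite (_ : [set Q in _ | _] = avoiding [set P : {set edge G} | prefix n P]).
    apply: avoiding_collapsible => //.
    + by rewrite inE; apply/negP => /(prefix_neq0 n0 n0)/eqP.
    + by move=> T; rewrite inE; exists n.
    + by move=> P; rewrite inE.
    + move=> i i' P P' pP pP'; rewrite !inE => pnP ii'.
      have [ni|lin] := leqP n i.
        by apply: prefix_cap pP'; exact: leq_trans (ltnW ii').
      have := prefix_center (Ordinal lin) pP.
      by rewrite (prefix_center _ pnP) /= lin ltnn.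
  (* Since critical matchings are facets, differing from all of them is the same as containing
     none. *)
  apply/setP => Q; rewrite !inE; apply: andb_id2l => mQ.
  apply/forallP/forall_inP => [Qs P|aQ j].
    rewrite inE => pP; have [j sj] := s_surj P pP.
    by apply: contra (Qs j) => sPQ; rewrite (prefix_maximal pP mQ sPQ) sj.
  apply: contra (aQ (s j) _) => [/eqP -> //|]; by rewrite inE.
- exists (inord t0); rewrite inordK //; exact: Ordinal ct0.
Qed.

End Conclusion.

Local Close Scope ring_scope.
Local Close Scope classical_set_scope.

Local Close Scope ring_scope.
Local Close Scope classical_set_scope.

Theorem theorem5p4 (R : realType) (m n : nat) (hm : 2 <= m) (hn : 1 <= n) :
  (forall k : nat, n = 2 * k ->
     homotopy_equivalent R
       (realization R (matching_complex (perfect_caterpillar m n)))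
       (wedge_spheres R k (alpha m k) (fun t => k - 1 + t))) /\
  (forall k : nat, n = 2 * k + 1 ->
     homotopy_equivalent R
       (realization R (matching_complex (perfect_caterpillar m n)))
       (wedge_spheres R k (beta m k) (fun t => k + t))).
Proof.
case: m hm => [//|m] hm; split => k nk.
- apply: wedge_of_prefixes => //.
  (* Here [k] is positive, so [k - 1] is not truncated; [k + t] tiles on [2 * k] vertices make
     [k - t] dominoes and [2 * t] singles. *)
  + move=> t tk; rewrite card_prefixes // ifT; last by lia.
    by rewrite /alpha; congr (binomial _ _ * _ ^ _)%N; lia.
  + by move=> t t' tk t'k; lia.
  + move=> P /prefix_size /andP[h1 h2]; exists (#|P| - k)%N; lia.
  (* At [t = k] there are only single tiles, and a colour exists because there are at least two
     legs. *)
  + exists k => //; rewrite /alpha subnn bin0 mul1n expn_gt0; lia.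
- apply: wedge_of_prefixes => //.
  (* Now [k + 1 + t] tiles on [2 * k + 1] vertices make [k - t] dominoes and [2 * t + 1] singles. *)
  + move=> t tk; rewrite card_prefixes // ifT; last by lia.
    by rewrite /beta; congr (binomial _ _ * _ ^ _)%N; lia.
  + by move=> t t' tk t'k; lia.
  + move=> P /prefix_size /andP[h1 h2]; exists (#|P| - k.+1)%N; lia.
  + exists k => //; rewrite /beta subnn bin0 mul1n expn_gt0; lia.
Qed.
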